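(* Let $n\ge1$. For every $f\in\bigcup_{s>n/2}H^s(\mathbb{T}^n)$, $$\langle h_L,f\rangle_{\mathbb{T}^n_L}\to\langle h,f\rangle_{\mathbb{T}^n}\quad\text{in }L^2(\mathbf P)\text{ as }L\to\infty\ (L\text{ odd}),$$ where $h$ is the polyharmonic Gaussian field on the continuous torus $\mathbb{T}^n$ and $h_L$ the polyharmonic Gaussian field on the discrete torus $\mathbb{T}^n_L$, built from the same i.i.d. standard normal variables as described in the context.
   Context: $\mathbb{T}^n=(\mathbb{R}/\mathbb{Z})^n$ with Lebesgue measure; $L$ is an odd positive integer; $\mathbb{T}^n_L=(\frac1L\mathbb{Z})^n/\mathbb{Z}^n\subset\mathbb{T}^n$; $\mathbb{Z}^n_L=\{z\in\mathbb{Z}^n:\max_k|z_k|<L/2\}$; $a_n=\frac{2}{\Gamma(n/2)(4\pi)^{n/2}}$; $\lambda_z=(2\pi|z|)^2$; $\lambda_{L,z}=4L^2\sum_{k=1}^n\sin^2(\pi z_k/L)$. Fix $\hat{\mathbb{Z}}^n\subset\mathbb{Z}^n\setminus\{0\}$ with $\mathbb{Z}^n\setminus\{0\}=\hat{\mathbb{Z}}^n\,\dot\cup\,(-\hat{\mathbb{Z}}^n)$ and set $\varphi_0=1$, $\varphi_z(x)=\sqrt2\cos(2\pi z\cdot x)$ for $z\in\hat{\mathbb{Z}}^n$, $\varphi_z(x)=\sqrt2\sin(2\pi z\cdot x)$ for $z\in-\hat{\mathbb{Z}}^n$; this is an orthonormal basis of $L^2(\mathbb{T}^n)$. $H^s(\mathbb{T}^n)$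 is the Sobolev space of $f=\sum_{z\in\mathbb{Z}^n}\alpha_z\varphi_z$, $\alpha_z\in\mathbb{R}$, with $\sum_{z\ne0}|z|^{2s}\alpha_z^2<\infty$; for $s>n/2$ its elements are continuous and are evaluated pointwise on $\mathbb{T}^n_L$. $\langle f,g\rangle_{\mathbb{T}^n_L}=L^{-n}\sum_{v\in\mathbb{T}^n_L}f(v)g(v)$. Fields: let $(\xi_z)_{z\in\mathbb{Z}^n\setminus\{0\}}$ be i.i.d. standard normal variables on a probability space $(\Omega,\mathfrak A,\mathbf P)$. The polyharmonic field on $\mathbb{T}^n$ is $h=a_n^{-1/2}\sum_{z\ne0}\lambda_z^{-n/4}\xi_z\varphi_z$, with $\langle h,f\rangle_{\mathbb{T}^n}=a_n^{-1/2}\sum_{z\neq0}\lambda_z^{-n/4}\xi_z\alpha_z$ (convergent in $L^2(\mathbf P)$) for $f=\sum_z\alpha_z\varphi_z$. The polyharmonic field on $\mathbb{T}^n_L$ is $h_L(v)=a_n^{-1/2}\sum_{z\in\mathbb{Z}^n_L\setminus\{0\}}\lambda_{L,z}^{-n/4}\xi_z\varphi_z(v)$. *)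

(* Defs.v *)
From HB Require Import structures.
From mathcomp Require Import all_boot all_order all_algebra.
From mathcomp Require Import all_classical all_reals all_analysis.

Set Implicit Arguments.
Unset Strict Implicit.
Unset Printing Implicit Defensive.
Import Order.TTheory GRing.Theory Num.Theory.
Import numFieldNormedType.Exports.
Local Open Scope classical_set_scope.
Local Open Scope ring_scope.

(* Conventions: Z^n is 'rV[int]_n; a function on T^n = (R/Z)^n is a
   Z^n-periodic function on 'rV[R]_n. *)

Section L2_series.
Context d (T : measurableType d) (R : realType).
Variable mu : {measure set T -> \bar R}.
Variable I : choiceType.

(* g is the unconditional L^2(mu)-sum of the u z, z in D: the partial sums
   converge to g along the finite subsets of D. *)
Definition is_L2_sum (D : set I) (u : I -> T -> R) (g : T -> R) :=
  measurable_fun setT g /\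
  forall e : R, 0 < e -> exists2 A, fsets D A &
    forall B, fsets D B -> A `<=` B ->
      ('N[mu]_2%:E[(fun t => (g t - \sum_(z \in B) u z t)%:E)] < e%:E)%E.

(* Determined up to mu-null sets when the series converges, and 0 when it
   does not. *)
Definition L2_sum (D : set I) (u : I -> T -> R) : T -> R :=
  xget (fun=> 0) [set g | is_L2_sum D u g].

End L2_series.

Section independence.
Context d (T : measurableType d) (R : realType) (P : probability T R).
Variable I : choiceType.

Definition mutually_independent (D : set I) (X : I -> {RV P >-> R}) :=
  forall (s : seq I) (B : I -> set R),
    uniq s -> (forall i, i \in s -> D i) ->
    (forall i, i \in s -> measurable (B i)) ->
    (P (\big[setI/setT]_(i <- s) (X i @^-1` B i)) =
     \prod_(i <- s) P (X i @^-1` B i))%E.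

Definition iid_standard_normal (D : set I) (X : I -> {RV P >-> R}) :=
  mutually_independent D X /\
  forall i, D i -> forall B : set R, measurable B ->
    distribution P (X i) B = normal_prob 0 1 B.

End independence.

Section torus.
Context {R : realType}.

(* Lebesgue measure on [0,1]^n, a fundamental domain of T^n: the n-fold product
   of Lebesgue measure on [0,1], which is uniform_prob (@ltr01 R).  The library
   puts Lebesgue measure on measurableTypeR R, a copy of R. *)
Local Notation RM := (measurableTypeR R).

Section torus_measure.
Variable n : nat.
Let cons_tuple (p : RM * n.-tuple RM) : n.+1.-tuple RM :=
  [tuple of p.1 :: p.2].

Let measurable_cons_tuple : measurable_fun setT cons_tuple.
Proof. exact: measurable_cons. Qed.

HB.instance Definition _ := isMeasurableFun.Build _ _ _ _ cons_tuple
  measurable_cons_tuple.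

Definition torus_measureS (mu : probability (n.-tuple RM) R) :
    probability (n.+1.-tuple RM) R :=
  distribution (uniform_prob (@ltr01 R) \x mu)%E cons_tuple.

End torus_measure.

Fixpoint torus_measure (n : nat) : probability (n.-tuple RM) R :=
  match n with
  | 0%N => \d_([tuple] : 0.-tuple RM)
  | m.+1 => torus_measureS (torus_measure m)
  end.

Variable n : nat.
Implicit Types (z : 'rV[int]_n) (x : 'rV[R]_n) (f g : 'rV[R]_n -> R).

Definition row_of_tuple (t : n.-tuple RM) : 'rV[R]_n := \row_i tnth t i.

Definition periodic f := forall x z, f (x + map_mx intr z) = f x.

(* The Z^n-periodic continuous function almost everywhere equal to f (unique
   if it exists, 0 otherwise). *)
Definition continuous_version f : 'rV[R]_n -> R :=
  xget (fun=> 0) [set g | [/\ periodic g, continuous g &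
    {ae torus_measure n, forall t, g (row_of_tuple t) = f (row_of_tuple t)}]].

Definition half_lattice (Zhat : set 'rV[int]_n) :=
  [set z | z != 0] = Zhat `|` (-%R @` Zhat) /\ Zhat `&` (-%R @` Zhat) = set0.

Definition lattice_norm z : R := Num.sqrt (\sum_k (z 0 k)%:~R ^+ 2).

Definition lattice_dot z x : R := \sum_k (z 0 k)%:~R * x 0 k.

Definition eigenfun (Zhat : set 'rV[int]_n) z x : R :=
  if z == 0 then 1
  else if z \in Zhat then Num.sqrt 2 * cos (2 * pi * lattice_dot z x)
  else Num.sqrt 2 * sin (2 * pi * lattice_dot z x).

(* f belongs to H^s(T^n), with expansion sum_z alpha z * phi_z in L^2(T^n).
   As usual f stands for its class modulo equality almost everywhere. *)
Definition sobolev (Zhat : set 'rV[int]_n) (s : R) (alpha : 'rV[int]_n -> R) f :=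
  [/\ periodic f,
      is_L2_sum (torus_measure n) setT
        (fun z t => alpha z * eigenfun Zhat z (row_of_tuple t))
        (f \o row_of_tuple) &
      (\esum_(z in [set z | z != 0%R])
         (lattice_norm z `^ (2 * s) * alpha z ^+ 2)%:E < +oo)%E].

Definition eigenval z : R := (2 * pi * lattice_norm z) ^+ 2.

Definition discrete_eigenval (L : nat) z : R :=
  4 * L%:R ^+ 2 * \sum_k sin (pi * (z 0 k)%:~R / L%:R) ^+ 2.

Definition Gamma (r : R) : R :=
  \int[lebesgue_measure]_(t in `]0, +oo[) (t `^ (r - 1) * expR (- t)).

Definition field_const : R :=
  2 / (Gamma (n%:R / 2) * (4 * pi) `^ (n%:R / 2)).

Definition discrete_lattice (L : nat) : set 'rV[int]_n :=
  [set z | forall k, `|z 0 k|%:~R < L%:R / 2 :> R].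

(* The representative of the class of j / L in T^n_L. *)
Definition discrete_torus_pt (L : nat) (j : 'rV['I_L]_n) : 'rV[R]_n :=
  map_mx (fun i : 'I_L => (i : nat)%:R / L%:R) j.

Definition discrete_pairing (L : nat) f g : R :=
  (L%:R ^+ n)^-1 *
  \sum_(j : 'rV['I_L]_n) f (discrete_torus_pt j) * g (discrete_torus_pt j).

Section fields.
Context d (Omega : measurableType d) (P : probability Omega R).
Variables (Zhat : set 'rV[int]_n) (xi : 'rV[int]_n -> {RV P >-> R}).

Definition discrete_field (L : nat) (w : Omega) (v : 'rV[R]_n) : R :=
  field_const `^ (- 2^-1) *
  \sum_(z \in discrete_lattice L `\ 0)
    discrete_eigenval L z `^ (- (n%:R / 4)) * xi z w * eigenfun Zhat z v.

(* <h, f> for the polyharmonic field h on T^n, as a function of the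
   coefficients alpha of f. *)
Definition field_pairing (alpha : 'rV[int]_n -> R) (w : Omega) : R :=
  field_const `^ (- 2^-1) *
  L2_sum P [set z | z != 0]
    (fun z w => eigenval z `^ (- (n%:R / 4)) * xi z w * alpha z) w.

End fields.
End torus.

(* Main.v *)
(** Sobolev regularity [s > n/2] makes the Fourier coefficients [alpha] of [f]
    absolutely summable, so the continuous version of [f] is the uniform limit
    of its Fourier series and both pairings become series in the [xi z] that
    converge absolutely in L^2(P), the [xi z] having a common second moment.  On
    the discrete torus the [phi_z] with [z] in [Z^n_L] are orthonormal, and any frequency [w] aliases to at most two of them,
    i.e. [sum_z |<phi_z, phi_w>_L| <= 2].  Fix a finite set [A] of frequencies off
    which [sum |alpha|] is at most [e].  For large [L] the frequencies outside
    [A] contribute [O(e)] to the L^2 error, because all weights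
    [lambda_{L,z}^(-n/4)] are at most 1; the finitely many terms in [A] converge
    since [lambda_{L,z}] tends to [lambda_z]. *)

Require Import Defs.
From HB Require Import structures.
From mathcomp Require Import all_boot all_order all_algebra.
From mathcomp Require Import finmap.
From mathcomp Require Import all_classical all_reals all_analysis.
From mathcomp Require Import measurable_realfun ring lra zify.

Set Implicit Arguments.
Unset Strict Implicit.
Unset Printing Implicit Defensive.
Import Order.TTheory GRing.Theory Num.Theory.
Import numFieldNormedType.Exports.
Local Open Scope classical_set_scope.
Local Open Scope ring_scope.

(** * Absolutely summable families *)

Section tails.
Context {R : realType} {I : choiceType}.
Implicit Types (u : I -> R) (A B : {fset I}) (M : R).

(** [L2_sum] and [continuous_version] are picked by [xget] and fall back to 0 when nothing
    qualifies, so their defining properties become available only once a witness is built. For the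
    field the witness comes from a Riesz-Fischer construction. For [f] it is the Fourier series, and
    identifying it with the chosen version also requires that the torus measure charges every small
    box. Summability of [alpha] comes from the arithmetic-geometric inequality against [|z|^(-2s)];
    after that, Minkowski's inequality in L^2 bounds every error. All summation estimates go through
    [tail_le u A M], which bounds the absolute sum over every finite set disjoint from [A]. With
    [A = fset0] it is absolute summability, and small tails are handled with finite real sums
    only. *)

Definition tail_le u A M :=
  forall B, [disjoint A & B]%fset -> \sum_(z <- B) `|u z| <= M.

Lemma tail_le_ge0 u A M : tail_le u A M -> 0 <= M.
Proof. by move=> /(_ fset0); rewrite big_seq_fset0 fdisjointX0; exact. Qed.

Lemma tail_leS u A B M : (A `<=` B)%fset -> tail_le u A M -> tail_le u B M.
Proof. by move=> AB tA C BC; apply: tA; exact: fdisjointWl BC. Qed.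

Lemma tail_le_bound u M B : tail_le u fset0 M -> \sum_(z <- B) `|u z| <= M.
Proof. by apply; rewrite fdisjoint0X. Qed.

Lemma tail_le_mono u v A M :
  (forall z, `|u z| <= `|v z|) -> tail_le v A M -> tail_le u A M.
Proof.
by move=> uv tv B AB; apply: le_trans (tv B AB); apply: ler_sum => z _.
Qed.

Lemma sum_fsetD (V : zmodType) (F : I -> V) A B : (A `<=` B)%fset ->
  \sum_(z <- B) F z = \sum_(z <- A) F z + \sum_(z <- (B `\` A)%fset) F z.
Proof.
move=> AB; rewrite (big_fsetID _ (mem A))/=; congr (_ + _).
  apply: eq_fbigl => z; rewrite !inE/=.
  by have [zA|] := boolP (z \in A); [rewrite (fsubsetP AB)|rewrite andbF].
by apply: eq_fbigl => z; rewrite !inE/= andbC.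
Qed.

Lemma fsbig_fset (F : I -> R) A : \sum_(z \in [set` A]) F z = \sum_(z <- A) F z.
Proof. by rewrite fsbig_finite//= set_fsetK. Qed.

Lemma fdisjoint_fsetD A B : [disjoint A & (B `\` A)]%fset.
Proof. by apply/fdisjointP => z zA; rewrite inE zA. Qed.

Lemma ler_sum_tail u A B M : (A `<=` B)%fset -> tail_le u A M ->
  `|\sum_(z <- B) u z - \sum_(z <- A) u z| <= M.
Proof.
move=> AB tA; rewrite (sum_fsetD _ AB) addrAC subrr add0r.
by rewrite (le_trans (ler_norm_sum _ _ _))// tA// fdisjoint_fsetD.
Qed.

(** Take [A] whose absolute sum is within [e] of the supremum over finite sets: a set [B] disjoint
    from [A] can add at most [e] before [A] and [B] together exceed that supremum. *)
Lemma tail_le_small u M e : tail_le u fset0 M -> 0 < e ->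
  exists A, tail_le u A e.
Proof.
move=> tM e0.
pose S := [set \sum_(z <- B) `|u z| | B in [set: {fset I}]].
have supS : has_sup S.
  split; first by exists (\sum_(z <- fset0) `|u z|), fset0.
  by exists M => _ [B _ <-]; exact: tail_le_bound.
have [_ [A _ <-] lA] := sup_adherent e0 supS.
exists A => B AB.
have : \sum_(z <- (A `|` B)%fset) `|u z| <= sup S.
  by apply: (ub_le_sup supS.2); exists (A `|` B)%fset.
rewrite (sum_fsetD _ (fsubsetUl A B)).
rewrite (_ : (_ `\` _)%fset = B).
  by move: lA; rewrite ltrBlDr => lA /le_lt_trans/(_ lA); rewrite ltrD2l => /ltW.
apply/fsetP => z; rewrite !inE; have [zA|//] := boolP (z \in A).
by rewrite (negbTE (fdisjointP AB _ zA)).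
Qed.

End tails.

Section countable_sums.
Context {R : realType} {I : countType}.
Implicit Types (u : I -> R) (A B : {fset I}) (M : R).

(** An increasing exhaustion of the index type by pickling codes; it turns unordered sums into
    limits of sequences. *)
Definition enum_upto N : {fset I} :=
  [fset z in pmap pickle_inv (iota 0 N)]%fset.

Lemma in_enum_upto N z : (z \in enum_upto N) = (choice.pickle z < N)%N.
Proof.
rewrite inE/= mem_pmap; apply/mapP/idP => [[k]|zN].
  rewrite mem_iota/= add0n => kN /esym zk.
  by have := @pickle_invK I k; rewrite zk/= => ->.
by exists (choice.pickle z); rewrite ?pickleK_inv// mem_iota.
Qed.

Lemma enum_uptoS m k : (m <= k)%N -> (enum_upto m `<=` enum_upto k)%fset.
Proof.
by move=> mk; apply/fsubsetP => z; rewrite !in_enum_upto => /leq_trans; exact.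
Qed.

Lemma enum_upto_exhaust A : exists N, forall m, (N <= m)%N ->
  (A `<=` enum_upto m)%fset.
Proof.
exists (\max_(z <- A) (choice.pickle z).+1) => m Nm; apply/fsubsetP => z zA.
by rewrite in_enum_upto (leq_trans _ Nm)//
  (@leq_bigmax_seq _ _ _ (fun z => (choice.pickle z).+1)).
Qed.

Lemma tail_le_sums u M :
  (forall N, \sum_(z <- enum_upto N) `|u z| <= M) -> tail_le u fset0 M.
Proof.
move=> uM B _; have [N /(_ N (leqnn N)) BN] := enum_upto_exhaust B.
by rewrite (le_trans _ (uM N))// (sum_fsetD _ BN) lerDl sumr_ge0.
Qed.

Lemma cvg_enum_upto u M : tail_le u fset0 M ->
  cvgn (fun N => \sum_(z <- enum_upto N) u z).
Proof.
move=> tu; apply/cauchy_cvgP/cauchy_exP => e e0.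
have [A tA] := tail_le_small tu (divr_gt0 e0 (@ltr0n R 2)).
have [N AN] := enum_upto_exhaust A.
exists (\sum_(z <- A) u z); exists N => // m /= /AN Am.
rewrite /ball/= distrC (le_lt_trans (ler_sum_tail Am tA))//.
by rewrite ltr_pdivrMr// ltr_pMr// ltr1n.
Qed.

Definition sum_all u : R := limn (fun N => \sum_(z <- enum_upto N) u z).

Lemma cvg_sum_all u M : tail_le u fset0 M ->
  \sum_(z <- enum_upto N) u z @[N --> \oo] --> sum_all u.
Proof. exact: cvg_enum_upto. Qed.

(** [enum_upto N] eventually contains [A], so the bound holds for late partial sums and passes to
    the limit. *)
Lemma sum_all_tail u A M M' : tail_le u fset0 M' -> tail_le u A M ->
  `|sum_all u - \sum_(z <- A) u z| <= M.
Proof.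
move=> tu tA; have [N AN] := enum_upto_exhaust A.
have h : `|\sum_(z <- enum_upto N) u z - \sum_(z <- A) u z| @[N --> \oo] -->
    `|sum_all u - \sum_(z <- A) u z|.
  by apply: cvg_norm; apply: cvgB; [exact: cvg_sum_all tu|exact: cvg_cst].
rewrite -(cvg_lim _ h)//; apply: limr_le; first exact: cvgP h.
by exists N => // m /= /AN Am; exact: ler_sum_tail.
Qed.

End countable_sums.

(** * The L^2 norm and L^2 sums *)

Section L2_norm.
Context d (T : measurableType d) (R : realType).
Variable mu : {measure set T -> \bar R}.
Implicit Types (f g : T -> R) (M c : R).
Local Notation "''N2' [ f ]" := ('N[mu]_2%:E[(fun t => (f t)%:E)])%E
  (at level 0, f at level 200).

Lemma Lnorm2_sqr f :
  ('N2[f] `^ 2 = \int[mu]_t (f t ^+ 2)%:E)%E.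
Proof.
rewrite powR_Lnorm//; apply: eq_integral => t _.
by rewrite abse_EFin poweR_EFin powR_mulrn// -normrX ger0_norm// sqr_ge0.
Qed.

(** Squaring is undone on [[0, +oo]] by the exponent 1/2, so infinite norms are covered. Norm bounds
    thereby become integral bounds, to which monotone convergence applies. *)
Lemma Lnorm2_leP f M : 0 <= M ->
  ('N2[f] <= M%:E)%E <-> (\int[mu]_t (f t ^+ 2)%:E <= (M ^+ 2)%:E)%E.
Proof.
move=> M0; rewrite -Lnorm2_sqr -powR_mulrn// -poweR_EFin.
have N0 := Lnorm_ge0 mu 2%:E (fun t => (f t)%:E).
have iN (x : \bar R) : (0 <= x)%E -> x \in `[0%E, +oo%E].
  by move=> x0; rewrite in_itv/= x0 leey.
split=> h; first by apply: gt0_ler_poweR => //; exact: iN.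
have sqrK (x : \bar R) : (0 <= x)%E -> ((x `^ 2) `^ 2^-1 = x)%E.
  by move=> x0; rewrite -poweRrM divff// poweRe1.
rewrite -(sqrK _ N0) -(sqrK M%:E)//.
by apply: gt0_ler_poweR; rewrite ?invr_ge0//; apply: iN; exact: poweR_ge0.
Qed.

Lemma le_Lnorm2 f g : measurable_fun setT f -> measurable_fun setT g ->
  (forall t, `|f t| <= `|g t|) -> ('N2[f] <= 'N2[g])%E.
Proof.
move=> mf mg fg.
have [->|gy] := eqVneq ('N2[g])%E +oo%E; first by rewrite leey.
have g0 := Lnorm_ge0 mu 2%:E (fun t => (g t)%:E).
have gfin : ('N2[g])%E \is a fin_num by rewrite ge0_fin_numE// lt_neqAle gy leey.
rewrite -(fineK gfin); apply/Lnorm2_leP; first by rewrite fine_ge0.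
apply: (@le_trans _ _ (\int[mu]_t (g t ^+ 2)%:E)%E); last first.
  by apply/Lnorm2_leP; rewrite ?fine_ge0// fineK.
apply: ge0_le_integral => //.
- by move=> t _; rewrite lee_fin sqr_ge0.
- by apply/measurable_EFinP; exact: measurable_funX.
- by apply/measurable_EFinP; exact: measurable_funX.
- move=> t _; rewrite lee_fin -[leLHS]ger0_norm ?sqr_ge0//.
  by rewrite -[leRHS]ger0_norm ?sqr_ge0// !normrX lerXn2r ?nnegrE.
Qed.

Lemma Lnorm2_scale f a c : measurable_fun setT f -> 0 <= c ->
  ('N2[f] <= c%:E)%E -> ('N2[(fun t => a * f t)] <= (`|a| * c)%:E)%E.
Proof.
move=> mf c0 /(Lnorm2_leP _ c0) fc; apply/Lnorm2_leP; first exact: mulr_ge0.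
under eq_integral do rewrite exprMn EFinM.
rewrite ge0_integralZl//.
- rewrite exprMn real_normK ?num_real// (EFinM (a ^+ 2)); apply: lee_pmul => //.
    by rewrite lee_fin sqr_ge0.
  by apply: integral_ge0 => t _; rewrite lee_fin sqr_ge0.
- by apply/measurable_EFinP; exact: measurable_funX.
- by move=> t _; rewrite lee_fin sqr_ge0.
- by rewrite lee_fin sqr_ge0.
Qed.

Lemma Lnorm2D f g a b : measurable_fun setT f -> measurable_fun setT g ->
  ('N2[f] <= a%:E)%E -> ('N2[g] <= b%:E)%E ->
  ('N2[(fun t => f t + g t)] <= (a + b)%:E)%E.
Proof.
move=> mf mg fa gb; rewrite EFinD.
by apply: le_trans (leeD fa gb); apply: minkowski_EFin; rewrite ?ler1n.
Qed.

Lemma Lnorm2N f : ('N2[(fun t => - f t)] = 'N2[f])%E.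
Proof. by rewrite -[RHS]oppe_Lnorm; apply: eq_Lnorm. Qed.

Lemma Lnorm2_sum (I : eqType) (s : seq I) (u : I -> T -> R) (c : I -> R) :
  (forall z, measurable_fun setT (u z)) ->
  (forall z, z \in s -> ('N2[u z] <= (c z)%:E)%E) ->
  ('N2[(fun t => (\sum_(z <- s) u z t)%R)] <= (\sum_(z <- s) c z)%:E)%E.
Proof.
elim: s => [|z s IH] mu_ uc.
  rewrite (_ : (fun t => _) = cst 0%E) ?Lnorm0 ?big_nil//.
  by apply/funext => t; rewrite big_nil.
rewrite big_cons (eq_Lnorm _ _ (g := fun t => (u z t + \sum_(z <- s) u z t)%:E)).
  apply: Lnorm2D.
  - exact: mu_.
  - exact: measurable_sum.
  - by apply: uc; rewrite mem_head.
  - by apply: IH => // y ys; apply: uc; rewrite in_cons ys orbT.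
by move=> t; rewrite big_cons.
Qed.

End L2_norm.

(** * Riesz-Fischer: series with summable L^2 norms have an unconditional L^2 sum *)

Section L2_sum_existence.
Context d (T : measurableType d) (R : realType).
Variable mu : {measure set T -> \bar R}.
Variable I : countType.
Variables (u : I -> T -> R) (c : I -> R).
Hypothesis mu_ : forall z, measurable_fun setT (u z).
Hypothesis uc : forall z, ('N[mu]_2%:E[(fun t => (u z t)%:E)] <= (c z)%:E)%E.

(** The upper limit is measurable without any convergence assumption, and it equals [sum_all]
    wherever the series converges absolutely. *)
Definition L2_limit (t : T) : R :=
  fine (limn_esup (fun N => (\sum_(z <- enum_upto N) u z t)%:E)).

Lemma measurable_L2_limit : measurable_fun setT L2_limit.
Proof.
apply: measurableT_comp => //; apply: measurable_fun_limn_esup => N.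
by apply/measurable_EFinP; exact: measurable_sum.
Qed.

Let c0 z : 0 <= c z.
Proof. by rewrite -lee_fin (le_trans _ (uc z))// Lnorm_ge0. Qed.

(** The majorant of the partial sums off [B]: being monotone in [N], it allows monotone convergence
    to replace an almost-everywhere argument. *)
Let W (B : {fset I}) N t : R := \sum_(z <- (enum_upto N `\` B)%fset) `|u z t|.

Let W_ge0 B N t : 0 <= W B N t. Proof. exact: sumr_ge0. Qed.

Let mW B N : measurable_fun setT (W B N).
Proof. by apply: measurable_sum => z; exact: measurableT_comp. Qed.

Let W_nd B t : {homo W B ^~ t : m n / (m <= n)%N >-> m <= n}.
Proof.
move=> m n mn; rewrite /W.
have h : (enum_upto m `\` B `<=` enum_upto n `\` B)%fset.
  by apply: fsetSD; exact: enum_uptoS.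
by rewrite (sum_fsetD _ h) lerDl sumr_ge0.
Qed.

(** Minkowski bounds the norm of each [W B N] by a sum of [c] off [B], hence by [M]; monotone
    convergence carries this to the limit. *)
Let int_W B M : tail_le c B M ->
  (\int[mu]_t limn (fun N => (W B N t ^+ 2)%:E) <= (M ^+ 2)%:E)%E.
Proof.
move=> cM; rewrite monotone_convergence//; first last.
- by move=> t _ m n mn; rewrite lee_fin lerXn2r ?nnegrE//; exact: W_nd.
- by move=> N t _; rewrite lee_fin sqr_ge0.
- by move=> N; apply/measurable_EFinP; exact: measurable_funX.
apply: lime_le.
  apply: ereal_nondecreasing_is_cvgn => m n mn; apply: ge0_le_integral => //.
  - by move=> t _; rewrite lee_fin sqr_ge0.
  - by apply/measurable_EFinP; exact: measurable_funX.
  - by apply/measurable_EFinP; exact: measurable_funX.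
  - by move=> t _; rewrite lee_fin lerXn2r ?nnegrE//; exact: W_nd.
apply: nearW => N; apply/(Lnorm2_leP mu (W B N) (tail_le_ge0 cM)).
apply: (@le_trans _ _ (\sum_(z <- (enum_upto N `\` B)%fset) c z)%:E).
  apply: Lnorm2_sum => z; first exact: measurableT_comp.
  move=> _.
  rewrite (le_trans _ (uc z))//; apply: le_Lnorm2 => //.
    exact: measurableT_comp.
  by move=> t; rewrite normr_id.
rewrite lee_fin; have := cM _ (fdisjoint_fsetD B (enum_upto N)).
by under eq_bigr do rewrite ger0_norm//.
Qed.

(* If the monotone limit is finite at [t] then the series converges absolutely
   there; otherwise the right-hand side is infinite. *)
Let L2_limit_W (B : {fset I}) t :
  (((L2_limit t - \sum_(z <- B) u z t) ^+ 2)%:E <=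
   limn (fun N => (W B N t ^+ 2)%:E))%E.
Proof.
set w := fun N => (W B N t ^+ 2)%:E.
have w_nd : {homo w : m n / (m <= n)%N >-> (m <= n)%E}.
  by move=> m n mn; rewrite lee_fin lerXn2r ?nnegrE//; exact: W_nd.
have wlim N : (w N <= limn w)%E.
  rewrite (cvg_lim _ (ereal_nondecreasing_cvgn w_nd))//.
  by apply: ereal_sup_ubound; exists N.
case: (limn w) wlim => [r||] wlim; last 2 first.
- by rewrite leey.
- by have := wlim 0%N.
have r0 : 0 <= r by have := wlim 0%N; rewrite lee_fin; apply: le_trans; exact: sqr_ge0.
have WB N : W B N t <= Num.sqrt r.
  by rewrite -(@ler_pXn2r _ 2%N) ?nnegrE ?sqrtr_ge0// sqr_sqrtr// -lee_fin wlim.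
have tB : tail_le (u ^~ t) B (Num.sqrt r).
  move=> C BC; have [N /(_ N (leqnn N)) CN] := enum_upto_exhaust C.
  apply: le_trans (WB N).
  have h : (C `<=` enum_upto N `\` B)%fset.
    apply/fsubsetP => z zC; rewrite inE (fsubsetP CN)// andbT.
    by apply: contraL zC => zB; exact: (fdisjointP BC).
  by rewrite /W (sum_fsetD _ h) lerDl sumr_ge0.
have t0 : tail_le (u ^~ t) fset0 (\sum_(z <- B) `|u z t| + Num.sqrt r).
  apply: tail_le_sums => N.
  rewrite (big_fsetID _ (mem B))/= lerD//.
    have h : ([fset z in enum_upto N | z \in B] `<=` B)%fset.
      by apply/fsubsetP => z; rewrite !inE => /andP[].
    by rewrite [leRHS](sum_fsetD _ h) lerDl sumr_ge0.
  by apply: tB; apply/fdisjointP => z zB; rewrite !inE/= zB andbF.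
have -> : L2_limit t = sum_all (u ^~ t).
  have h := cvg_sum_all t0.
  have eh : (\sum_(z <- enum_upto N) u z t)%:E @[N --> \oo] -->
      (sum_all (u ^~ t))%:E.
    by apply: cvg_EFin => //; exact: nearW.
  rewrite /L2_limit is_cvg_limn_esupE; last exact: cvgP eh.
  by rewrite (cvg_lim _ eh).
have h := sum_all_tail t0 tB.
by rewrite lee_fin -[leRHS](sqr_sqrtr r0) -[leLHS]real_normK ?num_real//
  lerXn2r ?nnegrE ?sqrtr_ge0.
Qed.

Lemma Lnorm2_L2_limit B M : tail_le c B M ->
  ('N[mu]_2%:E[(fun t => (L2_limit t - \sum_(z <- B) u z t)%:E)] <= M%:E)%E.
Proof.
move=> cM; apply/Lnorm2_leP; first exact: tail_le_ge0 cM.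
apply: le_trans (int_W cM); apply: ge0_le_integral => //.
- by move=> t _; rewrite lee_fin sqr_ge0.
- apply/measurable_EFinP; apply: measurable_funX; apply: measurable_funB.
    exact: measurable_L2_limit.
  exact: measurable_sum.
- apply: (emeasurable_fun_cvg (fun N t => (W B N t ^+ 2)%:E)).
    by move=> N; apply/measurable_EFinP; exact: measurable_funX.
  move=> t _; apply: ereal_nondecreasing_is_cvgn => m n mn.
  by rewrite lee_fin lerXn2r ?nnegrE//; exact: W_nd.
Qed.

End L2_sum_existence.

Lemma is_L2_sum_exists d (T : measurableType d) (R : realType)
    (mu : {measure set T -> \bar R}) (I : countType) (D : set I)
    (u : I -> T -> R) (c : I -> R) M :
  (forall z, D z -> measurable_fun setT (u z)) ->
  (forall z, D z -> 0 <= c z /\ ('N[mu]_2%:E[(fun t => (u z t)%:E)] <= (c z)%:E)%E) ->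
  tail_le c fset0 M -> exists g, is_L2_sum mu D u g.
Proof.
move=> mu_ uc cM.
(* Extension by zero off [D] reduces the claim to a series over the whole index type. *)
pose u' z := if z \in D then u z else cst 0.
pose c' z := if z \in D then c z else 0.
have mu' z : measurable_fun setT (u' z).
  by rewrite /u'; case: ifPn => [|_]; [rewrite inE; exact: mu_|].
have uc' z : ('N[mu]_2%:E[(fun t => (u' z t)%:E)] <= (c' z)%:E)%E.
  rewrite /u' /c'; case: ifPn => [|_]; first by rewrite inE => /uc[].
  by rewrite (_ : (fun _ => _) = cst 0%E)// Lnorm0.
have c'M : tail_le c' fset0 M.
  apply: tail_le_mono cM => z; rewrite /c'; case: ifPn => // _.
  by rewrite normr0.
exists (L2_limit u'); split; first exact: measurable_L2_limit.
move=> e e0; have [A tA] := tail_le_small c'M (divr_gt0 e0 (@ltr0n R 2)).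
exists (D `&` [set` A]).
  by split; [exact: finite_setIr|exact: subIsetl].
move=> B [finB BD] AB.
apply: (@le_lt_trans _ _ (e / 2)%:E); last first.
  by rewrite lte_fin ltr_pdivrMr// ltr_pMr// ltr1n.
have tB : tail_le c' (fset_set B) (e / 2).
  move=> C BC.
  (* The part of [C] inside [A] sums to 0: [c'] vanishes off [D], and the points of [D] in [A] lie
     in [B], which [C] avoids. *)
  rewrite (big_fsetID _ (mem A))/= [X in X + _]big1_fset ?add0r.
    apply: tA; apply/fdisjointP => z zA.
    by rewrite !inE/= zA andbF.
  move=> z; rewrite !inE/= => /andP[zC zA] _.
  rewrite /c'; case: ifPn; last by rewrite normr0.
  rewrite inE => Dz; have /(fdisjointP BC) : z \in fset_set B.
    by rewrite in_fset_set// inE; apply: AB.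
  by rewrite zC.
have := Lnorm2_L2_limit mu' uc' tB; rewrite (eq_Lnorm _ _ (g := fun t =>
  (L2_limit u' t - \sum_(z \in B) u z t)%:E))// => t.
rewrite fsbig_finite//=; congr (_ - _)%:E; apply: eq_fbigr => z.
by rewrite in_fset_set// inE => /BD Dz _; rewrite /u' mem_set.
Qed.

(** The abstract Radon-Nikodym derivative agrees almost everywhere with [normal_pdf], since both
    have the same integral over every measurable set. *)
Lemma ge0_integral_normal_prob (R : realType) (m s : R) (f : R -> \bar R) :
  measurable_fun setT f -> (forall x, 0 <= f x)%E ->
  (\int[normal_prob m s]_x f x =
   \int[lebesgue_measure]_x (f x * (normal_pdf m s x)%:E))%E.
Proof.
move=> mf f0; have numu := @normal_prob_dominates R m s.
rewrite -(Radon_Nikodym_SigmaFinite.change_of_variables numu f0 measurableT mf).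
have iRN := Radon_Nikodym_SigmaFinite.f_integrable numu.
have mRN : measurable_fun setT
    (Radon_Nikodym_SigmaFinite.f (normal_prob m s) lebesgue_measure).
  exact: measurable_int iRN.
apply: ae_eq_integral => //.
- exact: emeasurable_funM.
- apply: emeasurable_funM => //; apply/measurable_EFinP.
  exact: measurable_normal_pdf.
- apply: ae_eqe_mul2l; apply: integral_ae_eq => //.
    by apply/measurable_EFinP; exact: measurable_normal_pdf.
  by move=> E _ mE; rewrite -Radon_Nikodym_SigmaFinite.f_integral.
Qed.

Lemma normal_second_moment (R : realType) : exists2 K : R, 0 <= K &
  (\int[normal_prob 0 1]_x (x ^+ 2)%:E <= (K ^+ 2)%:E)%E.
Proof.
(* From [1 + x^2/4 <= exp(x^2/4)] one gets [x^2 exp(-x^2/2) <= 4 exp(-x^2/4)]. The right-hand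
   exponential is the unnormalised density of variance 2, which explains [s]; [C] collects the
   factor 4 and the two normalisations. *)
pose s : R := Num.sqrt 2.
have s_neq0 : s != 0 by rewrite sqrtr_eq0 -ltNge.
pose C := 4 * normal_peak 1 / normal_peak s.
have C0 : 0 <= C by rewrite divr_ge0// ?mulr_ge0// normal_peak_ge0.
exists (Num.sqrt C); rewrite ?sqrtr_ge0// sqr_sqrtr//.
rewrite ge0_integral_normal_prob//; last 2 first.
- by apply/measurable_EFinP; exact: measurable_funX.
- by move=> x; rewrite lee_fin sqr_ge0.
rewrite -[leRHS]mule1 -(@integral_normal_pdf R 0 s) -ge0_integralZl//; first last.
- by move=> x _; rewrite lee_fin normal_pdf_ge0.
- by apply/measurable_EFinP; exact: measurable_normal_pdf.
apply: ge0_le_integral => //.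
- by move=> x _; rewrite mule_ge0// lee_fin ?sqr_ge0// normal_pdf_ge0.
- apply: emeasurable_funM; apply/measurable_EFinP; first exact: measurable_funX.
  exact: measurable_normal_pdf.
- apply: emeasurable_funM => //; apply/measurable_EFinP.
  exact: measurable_normal_pdf.
move=> x _; rewrite -!EFinM lee_fin !normal_pdfE ?oner_eq0// /C.
rewrite [leRHS]mulrA divfK ?gt_eqF ?normal_peak_gt0//.
rewrite mulrCA [leRHS]mulrAC [leRHS]mulrC ler_wpM2l ?normal_peak_ge0//.
rewrite /normal_fun !subr0 expr1n /s sqr_sqrtr//.
have -> : - x ^+ 2 / (1 *+ 2) = - (x ^+ 2 / 4) + - x ^+ 2 / (2 *+ 2) :> R.
  by field.
rewrite expRD mulrA ler_wpM2r ?expR_ge0// expRN ler_pdivrMr ?expR_gt0//.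
have := expR_ge1Dx (x ^+ 2 / 4); lra.
Qed.

Lemma Lnorm2_standard_normal d (T : measurableType d) (R : realType)
    (P : probability T R) : exists2 K : R, 0 <= K &
  forall X : {RV P >-> R},
  (forall B, measurable B -> distribution P X B = normal_prob 0 1 B) ->
  ('N[P]_2%:E[(fun w => (X w)%:E)] <= K%:E)%E.
Proof.
have [K K0 hK] := @normal_second_moment R; exists K => // X XN.
apply/Lnorm2_leP => //; apply: le_trans hK.
pose Y : T -> measurableTypeR R := X.
have mY : measurable_fun setT Y by exact: (measurable_funP X).
have mf : measurable_fun setT (fun x : measurableTypeR R => (x ^+ 2)%:E).
  by apply/measurable_EFinP; exact: measurable_funX.
have -> : (\int[P]_w (X w ^+ 2)%:E =
    \int[P]_(w in Y @^-1` setT) ((fun x => (x ^+ 2)%:E) \o Y) w)%E.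
  by rewrite preimage_setT.
rewrite -(ge0_integral_pushforward mY P measurableT mf); last first.
  by move=> x _; rewrite lee_fin sqr_ge0.
rewrite (@eq_measure_integral _ _ _ _ (normal_prob 0 1))// => B mB _.
exact: XN.
Qed.

(** * Trigonometric sums on the discrete torus *)

Section trigonometry.
Context {R : realType}.
Implicit Types (x y : R) (m : int).

Lemma cos_add2piz x m : cos (x + 2 * pi * m%:~R) = cos x.
Proof.
have nat_case y k : cos (y + 2 * pi * k%:R) = cos y.
  rewrite -(periodicn (@cosD2pi R) k y); congr (cos (y + _)).
  by rewrite -mulr_natr -(mulr_natr pi 2); ring.
case: m => k; first exact: nat_case.
rewrite -(nat_case (x + 2 * pi * (Negz k)%:~R) k.+1); congr cos.
by rewrite NegzE mulrNz mulrN; exact: subrK.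
Qed.

Lemma sin_add2piz x m : sin (x + 2 * pi * m%:~R) = sin x.
Proof. by rewrite -!cosBpihalf addrAC cos_add2piz. Qed.

Lemma cos_eq1 x : 0 < x < 2 * pi -> cos x != 1.
Proof.
move=> /andP[x0 xpi]; have : 0 < sin (x / 2) by rewrite sin_gt0_pi//; lra.
have -> : cos x = 1 - 2 * sin (x / 2) ^+ 2.
  have -> : cos x = cos ((x / 2) *+ 2) by congr cos; rewrite -mulr_natr; lra.
  rewrite cos_mulr2n cos2sin2; ring.
move=> s0; apply/eqP => h.
have : 0 < sin (x / 2) ^+ 2 by rewrite exprn_gt0.
lra.
Qed.

Lemma cos_2pi_frac_neq1 (L : nat) m : (0 < L)%N -> ~~ (L %| m)%Z ->
  cos (2 * pi * (m%:~R / L%:R)) != 1 :> R.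
Proof.
move=> L0 Lm; have LR : (0 : R) < L%:R by rewrite ltr0n.
have Lz : L%:Z != 0 by lia.
rewrite {1}(divz_eq m L) intrD intrM.
have -> : 2 * pi * (((m %/ L)%Z%:~R * L%:Z%:~R + (m %% L)%Z%:~R) / L%:R) =
    2 * pi * ((m %% L)%Z%:~R / L%:R) + 2 * pi * (m %/ L)%Z%:~R :> R.
  by field; rewrite gt_eqF.
rewrite cos_add2piz cos_eq1//.
have r0 : 0 < (m %% L)%Z.
  rewrite lt_neqAle modz_ge0// andbT eq_sym.
  by apply: contra Lm => /eqP/dvdz_mod0P.
have rL : (m %% L)%Z < L%:Z by rewrite ltz_mod.
have q0 : 0 < (m %% L)%Z%:~R / L%:R :> R by rewrite divr_gt0// ltr0z.
have q1 : (m %% L)%Z%:~R / L%:R < 1 :> R.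
  by rewrite ltr_pdivrMr// mul1r -[L%:R]/(L%:Z%:~R) ltr_int.
have p0 := @pi_gt0 R.
apply/andP; split; first by apply: mulr_gt0 => //; exact: mulr_gt0.
by rewrite -[ltRHS]mulr1 ltr_pM2l// mulr_gt0.
Qed.

End trigonometry.

Section discrete_torus.
Context {R : realType} {n : nat}.
Variable L' : nat.
Local Notation L := L'.+1.
Implicit Types (u z w : 'rV[int]_n) (j : 'rV['I_L]_n).

Let LR0 : L%:R != 0 :> R. Proof. by rewrite pnatr_eq0. Qed.

Definition torus_angle u j : R := 2 * pi * lattice_dot u (discrete_torus_pt j).

Lemma lattice_dotD u z (x : 'rV[R]_n) :
  lattice_dot (u + z) x = lattice_dot u x + lattice_dot z x.
Proof.
rewrite /lattice_dot -big_split/=; apply: eq_bigr => k _.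
by rewrite mxE intrD mulrDl.
Qed.

Lemma lattice_dotN u (x : 'rV[R]_n) : lattice_dot (- u) x = - lattice_dot u x.
Proof.
rewrite /lattice_dot -sumrN; apply: eq_bigr => k _.
by rewrite mxE intrN mulNr.
Qed.

Lemma torus_angleD u z j : torus_angle (u + z) j = torus_angle u j + torus_angle z j.
Proof. by rewrite /torus_angle lattice_dotD mulrDr. Qed.

Lemma torus_angleB u z j : torus_angle (u - z) j = torus_angle u j - torus_angle z j.
Proof. by rewrite torus_angleD /torus_angle lattice_dotN mulrN. Qed.

Definition torus_shift (k : 'I_n) : 'rV['I_L]_n :=
  \row_i (if i == k then inZp 1 else 0).

Lemma torus_angle_shift u j k : exists m : int,
  torus_angle u (j + torus_shift k) =
  torus_angle u j + 2 * pi * ((u 0 k)%:~R / L%:R) + 2 * pi * m%:~R.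
Proof.
(* Addition in ['I_L] wraps around: the quotient is the carry of the [k]-th coordinate, and each
   carry lowers the angle by [2 pi u_k]. *)
exists (- (u 0 k * ((j 0%R k).+1 %/ L)%N%:Z)).
rewrite /torus_angle -!mulrDr; congr (_ * _).
rewrite /lattice_dot (bigD1 k)//= [in RHS](bigD1 k)//= !mxE eqxx.
rewrite (eq_bigr (fun i => (u 0 i)%:~R * discrete_torus_pt j 0 i)); last first.
  move=> i ik; rewrite !mxE (negbTE ik).
  by rewrite addr0.
rewrite /= modnDmr addn1.
have -> : ((j 0%R k).+1 %% L)%N%:R =
    (j 0 k)%:R + 1 - ((j 0%R k).+1 %/ L)%N%:R * L%:R :> R.
  by rewrite natr1 {2}(divn_eq (j 0 k).+1 L) natrD natrM addrAC subrr add0r.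
rewrite intrN intrM -!pmulrn; move: LR0.
by move: (L%:R : R) => l l0; field.
Qed.

Definition cos_sum u : R := \sum_j cos (torus_angle u j).
Definition sin_sum u : R := \sum_j sin (torus_angle u j).

(** These are the frequencies whose character is trivial on the discrete torus, that is, those
    aliased to 0. *)
Definition dvd_lattice u := [forall k, (L %| u 0%R k)%Z].

(* Translation by [1/L] in direction [k] permutes the torus and rotates the pair
   [(cos_sum u, sin_sum u)] by the angle [t]; a nontrivial rotation fixes only 0. *)
Lemma trig_sums_shift u k (t := 2 * pi * ((u 0 k)%:~R / L%:R)) :
  cos_sum u = cos t * cos_sum u - sin t * sin_sum u /\
  sin_sum u = sin t * cos_sum u + cos t * sin_sum u.
Proof.
split; rewrite {1}/cos_sum {1}/sin_sum
  (reindex_inj (@addIr _ (torus_shift k)))/= !big_distrr/=.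
- rewrite -sumrB; apply: eq_bigr => j _.
  have [m ->] := torus_angle_shift u j k.
  by rewrite cos_add2piz cosD -/t; ring.
- rewrite -big_split; apply: eq_bigr => j _ /=.
  have [m ->] := torus_angle_shift u j k.
  by rewrite sin_add2piz sinD -/t; ring.
Qed.

Lemma trig_sums_dvd u : dvd_lattice u ->
  cos_sum u = L%:R ^+ n /\ sin_sum u = 0.
Proof.
move=> /forallP Lu.
have angle0 j : exists m : int, torus_angle u j = 0 + 2 * pi * m%:~R.
  exists (\sum_k (u 0%R k %/ L)%Z * (j 0 k : nat)%:Z).
  rewrite add0r /torus_angle /lattice_dot; congr (_ * _).
  rewrite rmorph_sum/=; apply: eq_bigr => k _.
  rewrite mxE intrM -{1}(divzK (Lu k)) intrM /=.
  by rewrite -!pmulrn -mulrA (mulrC L%:R) divfK.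
split.
  rewrite /cos_sum (eq_bigr (fun=> 1)) => [|j _].
    by rewrite sumr_const card_mx card_ord mul1n -natrX.
  by have [m ->] := angle0 j; rewrite cos_add2piz cos0.
rewrite /sin_sum big1// => j _.
by have [m ->] := angle0 j; rewrite sin_add2piz sin0.
Qed.

Lemma trig_sums_ndvd u : ~~ dvd_lattice u -> cos_sum u = 0 /\ sin_sum u = 0.
Proof.
rewrite negb_forall => /existsP[k uk].
have [hc hs] := trig_sums_shift u k.
have := cos_2pi_frac_neq1 (R := R) (ltn0Sn L') uk.
set t := 2 * pi * _ in hc hs *; move: (cos2Dsin2 t) hc hs.
move: (cos t) (sin t) (cos_sum u) (sin_sum u) => c s C S cs1 hc hs c1.
have e0 : 1 - c != 0 by rewrite subr_eq0 eq_sym.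
(* Cramer's rule: [2 (1 - c) = (1 - c)^2 + s^2] is the determinant of the identity minus the
   rotation, nonzero because [c] is not 1. *)
have h1 : 2 * (1 - c) * C = 0.
  transitivity ((1 - c) * (C - (c * C - s * S)) + s * (s * C + c * S - S)
    + (1 - (c ^+ 2 + s ^+ 2)) * C); first by ring.
  by rewrite -hc -hs cs1; ring.
have h2 : 2 * (1 - c) * S = 0.
  transitivity ((1 - c) * (S - (s * C + c * S)) + s * (C - (c * C - s * S))
    + (1 - (c ^+ 2 + s ^+ 2)) * S); first by ring.
  by rewrite -hc -hs cs1; ring.
split; apply/eqP; [move/eqP: h1|move/eqP: h2];
  by rewrite !mulf_eq0 (negbTE e0) pnatr_eq0.
Qed.

Lemma sin_sum0 u : sin_sum u = 0.
Proof.
by case: (boolP (dvd_lattice u)) => [/trig_sums_dvd[]|/trig_sums_ndvd[]].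
Qed.

Lemma cos_sumE u : (L%:R ^+ n)^-1 * cos_sum u = (dvd_lattice u)%:R.
Proof.
have [/trig_sums_dvd[-> _]|/trig_sums_ndvd[-> _]] := boolP (dvd_lattice u).
  by rewrite mulVf// expf_neq0.
by rewrite mulr0.
Qed.

End discrete_torus.

(** * Orthonormality and aliasing of the trigonometric basis on the discrete torus *)

Section discrete_pairing.
Context {R : realType} {n : nat}.
Variable L' : nat.
Local Notation L := L'.+1.
Implicit Types (u z w : 'rV[int]_n) (j : 'rV['I_L]_n).
Local Notation torus_angle := (@torus_angle R n L').
Local Notation cos_sum := (@cos_sum R n L').
Local Notation sin_sum := (@sin_sum R n L').
Local Notation dvd_lattice := (@dvd_lattice n L').

Variable Zhat : set 'rV[int]_n.

Local Notation phi z := (@eigenfun R n Zhat z).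

Lemma pairing_eigenfun0 z : z != 0 -> ~~ dvd_lattice z ->
  discrete_pairing L (phi z) (phi 0) = 0.
Proof.
move=> z0 Lz; rewrite /discrete_pairing.
have [hc hs] := trig_sums_ndvd (R := R) Lz.
case: (boolP (z \in Zhat)) => zZ.
- rewrite (eq_bigr (fun j => Num.sqrt 2 * cos (torus_angle z j))).
    by rewrite -big_distrr/= -/(cos_sum z) hc !mulr0.
  by move=> j _; rewrite /eigenfun eqxx (negbTE z0) zZ mulr1.
- rewrite (eq_bigr (fun j => Num.sqrt 2 * sin (torus_angle z j))).
    by rewrite -big_distrr/= -/(sin_sum z) hs !mulr0.
  by move=> j _; rewrite /eigenfun eqxx (negbTE z0) (negbTE zZ) mulr1.
Qed.

(** Product-to-sum formulas, with [sqrt 2 * sqrt 2] absorbing their factor 2. The frequency [z + w]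
    enters with sign [+] for two cosines and [-] for two sines; mixed products leave only sine sums,
    which vanish. *)
Lemma pairing_eigenfun z w : z != 0 -> w != 0 ->
  discrete_pairing L (phi z) (phi w) =
  if (z \in Zhat) == (w \in Zhat) then
    (dvd_lattice (z - w))%:R + (-1) ^+ (z \notin Zhat) * (dvd_lattice (z + w))%:R
  else 0.
Proof.
move=> z0 w0; have s2 : Num.sqrt 2 * Num.sqrt 2 = 2 :> R.
  by rewrite -expr2 sqr_sqrtr.
rewrite -!cos_sumE mulrCA -mulrDr /discrete_pairing.
rewrite -[X in if _ then _ else X](mulr0 (L%:R ^+ n)^-1) -fun_if; congr (_ * _).
case: (boolP (z \in Zhat)) (boolP (w \in Zhat)) => zZ [] wZ /=.
- rewrite mul1r /cos_sum -big_split; apply: eq_bigr => j _ /=.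
  rewrite torus_angleB torus_angleD cosB cosD.
  rewrite /eigenfun (negbTE z0) (negbTE w0) zZ wZ -/(torus_angle z j).
  rewrite -/(torus_angle w j) mulrACA s2; ring.
- transitivity (sin_sum (z + w) - sin_sum (z - w)); last by rewrite !sin_sum0 subr0.
  rewrite /sin_sum -sumrB; apply: eq_bigr => j _ /=.
  rewrite torus_angleB torus_angleD sinB sinD.
  rewrite /eigenfun (negbTE z0) (negbTE w0) zZ (negbTE wZ) -/(torus_angle z j).
  rewrite -/(torus_angle w j) mulrACA s2; ring.
- transitivity (sin_sum (z - w) + sin_sum (z + w)); last by rewrite !sin_sum0 addr0.
  rewrite /sin_sum -big_split; apply: eq_bigr => j _ /=.
  rewrite torus_angleB torus_angleD sinB sinD.
  rewrite /eigenfun (negbTE z0) (negbTE w0) (negbTE zZ) wZ -/(torus_angle z j).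
  rewrite -/(torus_angle w j) mulrACA s2; ring.
- rewrite mulN1r /cos_sum -sumrB; apply: eq_bigr => j _ /=.
  rewrite torus_angleB torus_angleD cosB cosD.
  rewrite /eigenfun (negbTE z0) (negbTE w0) (negbTE zZ) (negbTE wZ) -/(torus_angle z j).
  rewrite -/(torus_angle w j) mulrACA s2; ring.
Qed.

Lemma pairing_eigenfun_le z w : z != 0 -> w != 0 ->
  `|discrete_pairing L (phi z) (phi w)| <=
  (dvd_lattice (z - w))%:R + (dvd_lattice (z + w))%:R.
Proof.
move=> z0 w0; rewrite pairing_eigenfun//; case: ifP => _.
  by rewrite (le_trans (ler_normD _ _))// normrM normrX normrN1 expr1n mul1r !normr_nat.
by rewrite normr0 addr_ge0.
Qed.

Local Notation ZL := (@discrete_lattice R n L).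

Lemma discrete_lattice_int z : ZL z <-> forall k, (`|z 0 k| *+ 2 < L%:Z)%R.
Proof.
have e k : (`|z 0 k|%:~R < L%:R / 2 :> R) = (`|z 0 k| *+ 2 < L%:Z).
  by rewrite ltr_pdivlMr// -[L%:R]/(L%:Z%:~R) mulr_natr -rmorphMn/= ltr_int.
by split=> h k; have := h k; rewrite e.
Qed.

Lemma discrete_latticeN z : ZL z -> ZL (- z).
Proof. by move=> h k; rewrite mxE normrN. Qed.

(** Coordinates below [L/2] in absolute value differ by less than [L], so a difference that is a
    multiple of [L] is 0. *)
Lemma discrete_lattice_inj z w : ZL z -> ZL w -> dvd_lattice (z - w) -> z = w.
Proof.
move=> /discrete_lattice_int hz /discrete_lattice_int hw /forallP h.
apply/rowP => k; apply/eqP; rewrite -subr_eq0.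
have := h k; rewrite !mxE => /dvdzP[q hq]; rewrite hq.
have [->|q0] := eqVneq q 0; first by rewrite mul0r.
have := ler_normB (z 0 k) (w 0 k); rewrite hq normrM.
have : `|L%:Z| <= `|q| * `|L%:Z| by rewrite ler_peMl// -gtz0_ge1 normr_gt0.
move: (`|q| * _) (hz k) (hw k) => x; rewrite !mulr2n; lia.
Qed.

Lemma discrete_lattice_ndvd z : ZL z -> z != 0 -> ~~ dvd_lattice z.
Proof.
move=> hz; apply: contra => h; apply/eqP; apply: discrete_lattice_inj => //.
  by move=> k; rewrite mxE normr0 divr_gt0// ltr0n.
by rewrite subr0.
Qed.

(** The term at [z + w] must be excluded. By symmetry of the box, [z + w] divisible by [L] means
    [w = - z]. For [w = z] this forces [z = 0]; otherwise exactly one of [z] and [- z] lies in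
    [Zhat], so the two functions are not of the same kind. *)
Lemma pairing_orthonormal z w : half_lattice Zhat ->
  ZL z -> ZL w -> z != 0 ->
  discrete_pairing L (phi z) (phi w) = (z == w)%:R.
Proof.
move=> [Zcov Zdis] hz hw z0; have [->|w0] := eqVneq w 0.
  by rewrite pairing_eigenfun0 ?discrete_lattice_ndvd// (negbTE z0).
have d1 : dvd_lattice (z - w) = (z == w).
  apply/idP/eqP => [|->]; first exact: discrete_lattice_inj.
  by rewrite subrr; apply/forallP => k; rewrite mxE dvdz0.
rewrite pairing_eigenfun// d1.
have [<-|zw] := eqVneq z w; rewrite ?eqxx.
  suff /negbTE -> : ~~ dvd_lattice (z + z) by rewrite mulr0 addr0.
  apply/negP; rewrite -{2}(opprK z).
  move=> /(discrete_lattice_inj hz (discrete_latticeN hz)).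
  move=> zz; move: z0; apply/negP/negPn/eqP/rowP => k.
  move/rowP/(_ k): zz; rewrite !mxE => /eqP.
  by rewrite -addr_eq0 -mulr2n mulrn_eq0/= => /eqP.
case: eqP => // zwZ; suff /negbTE -> : ~~ dvd_lattice (z + w).
  by rewrite mulr0 addr0.
apply/negP; rewrite -{1}(opprK w).
move=> /(discrete_lattice_inj hz (discrete_latticeN hw)) zNw.
have : (Zhat `|` (-%R @` Zhat)) z by rewrite -Zcov.
have wN : w = - z by rewrite zNw opprK.
have dis y : Zhat y -> Zhat (- y) -> False.
  move=> hy hNy; have : set0 y.
    by rewrite -Zdis; split=> //; exists (- y); rewrite ?opprK.
  by [].
move=> [zZ|[y yZ yz]].
  have : w \in Zhat by rewrite -zwZ inE.
  by rewrite inE wN => /(dis _ zZ).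
have yw : y = w by rewrite wN -yz opprK.
have : z \in Zhat by rewrite zwZ inE -yw.
rewrite inE -yz; exact: dis.
Qed.

Lemma sum_natr_le1 (I : choiceType) (A : {fset I}) (b : pred I) :
  (forall y z : I, y \in A -> z \in A -> b y -> b z -> y = z) ->
  \sum_(z <- A) (b z)%:R <= 1 :> R.
Proof.
move=> h; have [/hasP[y yA by_]|/hasPn nb] := boolP (has b A).
  rewrite (big_fsetD1 y)//= by_ big1_fset ?addr0// => z.
  rewrite !inE => /andP[zy zA] _; apply/eqP; rewrite pnatr_eq0 eqb0.
  by apply: contra zy => bz; apply/eqP; exact: h.
by rewrite big1_fset// => z zA _; rewrite (negbTE (nb _ zA)).
Qed.

(** Each of the classes of [w] and [- w] modulo [L] has at most one representative in the box, and
    each contributes at most 1. *)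
Lemma sum_pairing_le2 (A : {fset 'rV[int]_n}) w :
  (forall z, z \in A -> z != 0 /\ ZL z) ->
  \sum_(z <- A) `|discrete_pairing L (phi z) (phi w)| <= 2.
Proof.
move=> hA; have [->|w0] := eqVneq w 0.
  rewrite big1_fset// => z /hA[z0 hz] _.
  by rewrite pairing_eigenfun0 ?normr0// discrete_lattice_ndvd.
apply: (@le_trans _ _ (\sum_(z <- A) ((dvd_lattice (z - w))%:R +
    (dvd_lattice (z + w))%:R))).
  rewrite big_seq [leRHS]big_seq; apply: ler_sum => z /hA[z0 _].
  exact: pairing_eigenfun_le.
have dvdB y z : dvd_lattice y -> dvd_lattice z -> dvd_lattice (y - z).
  move=> /forallP hy /forallP hz; apply/forallP => k.
  by rewrite !mxE rpredB.
rewrite big_split/= (_ : 2 = 1 + 1)// lerD// sum_natr_le1// => y z.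
- move=> /hA[_ hy] /hA[_ hz] /dvdB h /h; rewrite opprB addrA subrK.
  exact: discrete_lattice_inj.
- move=> /hA[_ hy] /hA[_ hz] /dvdB h /h; rewrite opprD addrACA subrr addr0.
  exact: discrete_lattice_inj.
Qed.

End discrete_pairing.

(** * Summability of Sobolev coefficients *)

Section lattice_series.
Context {R : realType}.

(* Dyadic condensation. *)
Lemma p_series_bound (p : R) : 1 < p -> exists C : R, forall N : nat,
  \sum_(1 <= m < N) m%:R `^ (- p) <= C.
Proof.
move=> p1; pose q : R := 2 `^ (1 - p).
have q0 : 0 <= q by exact: powR_ge0.
have q1 : q < 1.
  by rewrite /q /powR pnatr_eq0/= expR_lt1 nmulr_rlt0 ?ln_gt0 ?ltr1n// subr_lt0.
have qk k : (2 ^ k)%:R * (2 ^ k)%:R `^ (- p) = q ^+ k :> R.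
  have -> : (2 ^ k)%:R = 2 `^ k%:R :> R by rewrite natrX powR_mulrn.
  rewrite -powRrM -powRD; last by rewrite pnatr_eq0 implybT.
  by rewrite -powR_mulrn// -powRrM; congr (_ `^ _); ring.
have a_dec (m m' : nat) : (0 < m)%N -> (m <= m')%N ->
    m'%:R `^ (- p) <= m%:R `^ (- p) :> R.
  move=> m0 mm'; rewrite !powRN lef_pV2 ?posrE ?powR_gt0 ?ltr0n//; last first.
    exact: leq_trans mm'.
  by apply: ge0_ler_powR; rewrite ?nnegrE ?ler0n ?ler_nat//; lra.
(* The block from [2^K] to [2^(K+1)] has [2^K] terms, each at most [(2^K)^(-p)], hence sum at most
   [q^K]. *)
have dyadic K : \sum_(1 <= m < 2 ^ K) m%:R `^ (- p) <= \sum_(i < K) q ^+ i.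
  elim: K => [|K IH]; first by rewrite big_geq// big_ord0.
  rewrite big_ord_recr/= (big_cat_nat (n := 2 ^ K))/= ?expn_gt0 ?leq_exp2l//.
  rewrite lerD// -qk.
  apply: (@le_trans _ _ (\sum_(2 ^ K <= m < 2 ^ K.+1) (2 ^ K)%:R `^ (- p))).
    rewrite big_nat_cond [leRHS]big_nat_cond; apply: ler_sum => m.
    by rewrite andbT => /andP[Km _]; apply: a_dec; rewrite ?expn_gt0.
  rewrite big_const_nat iter_addr_0 expnS mul2n -addnn addnK.
  by rewrite mulr_natl.
exists (1 - q)^-1 => N.
apply: (@le_trans _ _ (\sum_(1 <= m < 2 ^ N) m%:R `^ (- p))).
  have [N1|N1] := leqP N 1.
    by rewrite big_geq// sumr_ge0// => i _; exact: powR_ge0.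
  have NN : (N <= 2 ^ N)%N by exact: ltnW (ltn_expl N (ltnSn 1)).
  rewrite [leRHS](big_cat_nat (ltnW N1) NN)/=.
  by rewrite lerDl sumr_ge0// => i _; exact: powR_ge0.
apply: (le_trans (dyadic N)).
have d0 : 0 < 1 - q by rewrite subr_gt0.
rewrite -[leRHS]mul1r ler_pdivlMr// mulrC -opprB mulNr -subrX1 opprB.
by rewrite gerBl exprn_ge0.
Qed.

Lemma lattice_norm_ge (n : nat) (z : 'rV[int]_n) k :
  `|z 0 k|%:~R <= lattice_norm z :> R.
Proof.
rewrite -[leLHS]ger0_norm ?ler0z ?normr_ge0// -sqrtr_sqr ler_wsqrtr//.
have -> : (`|z 0 k|%:~R : R) ^+ 2 = (z 0 k)%:~R ^+ 2.
  by rewrite intr_norm real_normK ?num_real.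
rewrite (bigD1 k)//= lerDl.
by apply: sumr_ge0 => i _; exact: sqr_ge0.
Qed.

Lemma lattice_norm_ge1 (n : nat) (z : 'rV[int]_n) : z != 0 ->
  1 <= lattice_norm z :> R.
Proof.
move=> z0; have [k zk] : exists k, z 0 k != 0.
  apply/existsP; apply: contraR z0; rewrite negb_exists => /forallP h.
  by apply/eqP/rowP => k; rewrite mxE; apply/eqP/negPn.
by apply: le_trans (lattice_norm_ge z k); rewrite ler1z -gtz0_ge1 normr_gt0.
Qed.

(* With p = 2s/n > 1 one has |z|^(-2s) <= prod_k max(1, |z_k|)^(-p), so the
   n-dimensional sum is dominated by a power of a one-dimensional p-series. *)
Lemma lattice_series_bound (n : nat) (s : R) : (1 <= n)%N -> n%:R / 2 < s ->
  exists K : R, tail_le (fun z : 'rV[int]_n =>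
    if z == 0 then 0 else lattice_norm z `^ (- (2 * s)) : R) fset0 K.
Proof.
move=> n1 ns; have n0 : (0 : R) < n%:R by rewrite ltr0n.
pose p := 2 * s / n%:R.
have p1 : 1 < p by rewrite ltr_pdivlMr// mul1r; lra.
have [C hC] := p_series_bound p1.
pose b (i : nat) : R := (maxn 1 i)%:R `^ (- p).
have sumb N : \sum_(i < N.+1) b i <= 1 + C.
  rewrite big_ord_recl lerD//; first by rewrite /b powR1.
  have := hC N.+1; rewrite big_add1/= big_mkord; apply: le_trans.
  by apply: ler_sum => i _; rewrite /b /bump/= add1n (maxn_idPr _).
(* Per coordinate: the factor 2 counts the signs, the 1 is the term at 0, and [C] bounds the
   positive values. *)
exists ((2 * (1 + C)) ^+ n) => B _.
pose N := (\max_(z <- B) \max_(k < n) `|z 0%R k|)%N.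
have hN z k : z \in B -> (`|z 0%R k| < N.+1)%N.
  move=> zB; rewrite ltnS.
  apply: leq_trans (@leq_bigmax_seq _ _ _ (fun z : 'rV[int]_n =>
    \max_(k < n) `|z 0%R k|)%N _ zB isT).
  exact: (@leq_bigmax _ (fun k => `|z 0%R k|)%N).
(* Coding by signs and absolute values is injective on [B], so the sum over [B] is dominated by a
   sum over all codes, which factors over the coordinates. *)
pose h (z : 'rV[int]_n) : {ffun 'I_n -> bool * 'I_N.+1} :=
  [ffun k => (z 0 k < 0, inord `|z 0%R k|%N)].
have h_inj : {in B &, injective h}.
  move=> z z' zB z'B /ffunP hzz; apply/rowP => k.
  have := hzz k; rewrite !ffunE => -[sg /(congr1 (@nat_of_ord _))].
  rewrite !inordK ?hN// => ab.
  by move: sg; move: (z 0 k) (z' 0 k) ab; lia.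
pose G (f : {ffun 'I_n -> bool * 'I_N.+1}) := \prod_k b (f k).2.
have G0 f : 0 <= G f by apply: prodr_ge0 => k _; exact: powR_ge0.
have zG z : z \in B ->
    `|if z == 0 then 0 else lattice_norm z `^ (- (2 * s)) : R| <= G (h z).
  move=> zB; case: ifPn => [_|z0]; first by rewrite normr0.
  rewrite ger0_norm ?powR_ge0//.
  have r1 := lattice_norm_ge1 z0.
  have r0 : 0 < lattice_norm z :> R by exact: lt_le_trans r1.
  have -> : lattice_norm z `^ (- (2 * s)) = \prod_(k < n) lattice_norm z `^ (- p) :> R.
    rewrite prodr_const card_ord -powR_mulrn ?powR_ge0// -powRrM; congr (_ `^ _).
    by rewrite /p mulNr divfK// gt_eqF.
  apply: ler_prod => k _; rewrite powR_ge0 /b ffunE/= inordK ?hN//.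
  rewrite !powRN lef_pV2 ?posrE ?powR_gt0 ?ltr0n ?leq_max//.
  apply: ge0_ler_powR; rewrite ?nnegrE ?ler0n ?(ltW r0)//; first by lra.
  have [z1|z1] := leqP 1 `|z 0%R k|%N; last exact: r1.
  by rewrite natr_absz lattice_norm_ge.
apply: (@le_trans _ _ (\sum_(z <- B) G (h z))).
  by rewrite big_seq [leRHS]big_seq; apply: ler_sum => z /zG.
rewrite -(big_map h xpredT G).
rewrite big_uniq/=; last by rewrite map_inj_in_uniq// fset_uniq.
apply: (@le_trans _ _ (\sum_f G f)).
  by rewrite [leRHS](bigID (mem (map h B)))/= lerDl sumr_ge0.
rewrite /G -(bigA_distr_bigA (fun _ (x : bool * 'I_N.+1) => b x.2))/=.
rewrite prodr_const card_ord lerXn2r ?nnegrE//.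
- by apply: sumr_ge0 => x _; exact: powR_ge0.
- rewrite mulr_ge0//; apply: le_trans (sumb 0%N).
  by apply: sumr_ge0 => x _; exact: powR_ge0.
- rewrite -(pair_bigA _ (fun _ i => b (nat_of_ord i)))/= sumr_const card_bool.
  by rewrite -[leLHS]mulr_natl ler_wpM2l// sumb.
Qed.

(** With [x = |z|^(2s)], [|alpha z| <= 1/x + x * alpha z ^ 2]: the first terms are summable because
    [2s > n], the second by the Sobolev condition. That condition says nothing about [z = 0], which
    is added by hand. *)
Lemma sobolev_summable (n : nat) (Zhat : set 'rV[int]_n) (s : R) alpha f :
  (1 <= n)%N -> n%:R / 2 < s -> sobolev Zhat s alpha f ->
  exists M, tail_le alpha fset0 M.
Proof.
move=> n1 ns [_ _ hE]; have [K hK] := lattice_series_bound n1 ns.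
set E := esum _ _ in hE.
pose x (z : 'rV[int]_n) : R := lattice_norm z `^ (2 * s).
have x0 z : z != 0 -> 0 < x z.
  by move=> z0; rewrite powR_gt0// (lt_le_trans _ (lattice_norm_ge1 z0)).
have E0 : (0 <= E)%E.
  by apply: esum_ge0 => z _; rewrite lee_fin mulr_ge0 ?powR_ge0 ?sqr_ge0.
have Efin : E \is a fin_num by rewrite ge0_fin_numE.
have hEB (B : {fset 'rV[int]_n}) : 0 \notin B ->
    \sum_(z <- B) x z * alpha z ^+ 2 <= fine E.
  move=> B0; rewrite -lee_fin fineK//; apply: ereal_sup_ubound.
  exists [set` B].
    by split=> // z /= zB; apply: contraNneq B0 => <-.
  by rewrite fsbig_finite//= set_fsetK sumEFin.
exists (`|alpha 0| + (K + fine E)) => B _.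
have : \sum_(z <- (B `\ 0)%fset) `|alpha z| <= K + fine E.
  have B0 : 0 \notin (B `\ 0)%fset by rewrite !inE eqxx.
  apply: le_trans (lerD (tail_le_bound (B `\ 0)%fset hK) (hEB _ B0)).
  rewrite -big_split/= big_seq [leRHS]big_seq; apply: ler_sum => z zB.
  have z0 : z != 0 by move: zB; rewrite !inE => /andP[].
  rewrite (negbTE z0) [X in _ <= X + _]ger0_norm ?powR_ge0// powRN -/(x z).
  have xz := x0 _ z0; rewrite -[alpha z ^+ 2]real_normK ?num_real//.
  move: (`|_|) => a; rewrite -subr_ge0.
  (* Completing the square makes the sign of the difference visible. *)
  have -> : (x z)^-1 + x z * a ^+ 2 - a =
      (x z)^-1 * ((x z * a - 2^-1) ^+ 2 + 3 / 4).
    by field; rewrite gt_eqF.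
  by rewrite mulr_ge0 ?invr_ge0 ?(ltW xz)// addr_ge0 ?sqr_ge0// divr_ge0.
have [B0|B0] := boolP (0 \in B).
  by move=> h; rewrite (big_fsetD1 0 B0)/= lerD2l.
by rewrite mem_fsetD1// => h; rewrite (le_trans h)// lerDr.
Qed.

End lattice_series.

(** * Fourier series and the continuous version *)

Lemma cvg_sum_seq (R : realType) (T I : Type) (F : set_system T) (FF : Filter F)
    (s : seq I) (f : I -> T -> R) (l : I -> R) :
  (forall i, f i x @[x --> F] --> l i) ->
  \sum_(i <- s) f i x @[x --> F] --> \sum_(i <- s) l i.
Proof.
move=> fl; elim: s => [|i s IH].
  rewrite big_nil (_ : (fun y => _) = cst 0); first exact: cvg_cst.
  by apply/funext => y; rewrite big_nil.
rewrite big_cons (_ : (fun y => _) = f i \+ (fun y => \sum_(i <- s) f i y)).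
  exact: (cvgD (fl i) IH).
by apply/funext => y; rewrite big_cons.
Qed.

(** * Continuous functions equal almost everywhere on the unit cube agree on it *)

Section torus_measure_boxes.
Context {R : realType}.
Local Notation RM := (measurableTypeR R).

Definition open_box (n : nat) (a b : 'I_n -> R) : set (n.-tuple RM) :=
  [set t | forall i, (a i < tnth t i < b i)%R].

Lemma measurable_open_box n (a b : 'I_n -> R) : measurable (open_box a b).
Proof.
rewrite (_ : open_box a b =
    \bigcap_(i in [set: 'I_n]) ((@tnth n RM)^~ i @^-1` `]a i, b i[)).
  apply: fin_bigcap_measurable => // i _.
  rewrite -[X in measurable X]setTI.
  exact: (@measurable_tnth _ RM n i measurableT _ (measurable_itv `]a i, b i[)).
by apply/seteqP; split => t h i; [move=> _|]; have := h i; rewrite /= in_itv//=; exact.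
Qed.

Lemma uniform_prob01_itv (a b : R) : 0 <= a -> a < b -> b <= 1 ->
  uniform_prob (@ltr01 R) `]a, b[ = (b - a)%:E.
Proof.
move=> a0 ab b1; rewrite /uniform_prob.
under eq_integral.
  move=> x; rewrite inE/= in_itv/= => /andP[ax xb].
  rewrite /uniform_pdf subr0 invr1 (ltW (le_lt_trans a0 ax)) (ltW (lt_le_trans xb b1)).
  over.
by rewrite integral_cst//= lebesgue_measure_itv/= lte_fin ab mul1e EFinB.
Qed.

Lemma torus_measure_open_box_gt0 n (a b : 'I_n -> R) :
  (forall i, [/\ 0 <= a i, a i < b i & b i <= 1]) ->
  (0 < torus_measure n (open_box a b))%E.
Proof.
elim: n a b => [|n IH] a b ab.
  rewrite /= diracE mem_set ?lte01// => -[]//.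
pose c i := a (lift ord0 i); pose e i := b (lift ord0 i).
have -> : torus_measure n.+1 (open_box a b) =
    (uniform_prob (@ltr01 R) \x torus_measure n)%E (`]a ord0, b ord0[ `*` open_box c e).
  rewrite /= /pushforward; congr (_ _).
  apply/seteqP; split => -[x t] /=.
    move=> h; split; first by have := h ord0; rewrite in_itv.
    by move=> i; have := h (lift ord0 i); rewrite tnthS.
  move=> [+ h] i; rewrite in_itv/= => x0.
  by case: (unliftP ord0 i) => [j|] ->; rewrite ?tnthS//; exact: h.
rewrite product_measure1E//; last exact: measurable_open_box.
have [a0 ab0 b1] := ab ord0.
have u0 : (0 < uniform_prob (@ltr01 R) `]a ord0, b ord0[)%E.
  by rewrite uniform_prob01_itv// lte_fin subr_gt0.
by apply: (mule_gt0 u0); apply: IH => i; exact: ab.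
Qed.

(** If the functions differ at [x], they differ on a ball, which contains an open box of positive
    measure; that box would lie in a null set. *)
Lemma continuous_eq_ae n (g1 g2 : 'rV[R]_n -> R) :
  continuous g1 -> continuous g2 ->
  {ae torus_measure n, forall t, g1 (row_of_tuple t) = g2 (row_of_tuple t)} ->
  forall x : 'rV[R]_n, (forall i, 0 <= x 0 i < 1) -> g1 x = g2 x.
Proof.
move=> c1 c2 [N [mN N0 hN]] x x01; apply: contrapT => /eqP; rewrite -subr_eq0 => g12.
have : \forall y \near x, g1 y - g2 y != 0.
  have cB : (g1 y - g2 y) @[y --> x] --> g1 x - g2 x.
    exact: (cvgB (c1 x) (c2 x)).
  exact: (cvgr_neq0 _ cB g12).
move=> /nbhs_ballP[e /= e0 he].
(* The box has [x] as its lower corner and is cut off at 1, so it stays inside the unit cube even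
   when [x] lies on a lower face; this needs each [x_i < 1]. *)
pose a i := x 0 i; pose b i := Num.min (x 0 i + e) 1.
have ab i : [/\ 0 <= a i, a i < b i & b i <= 1].
  have /andP[x0 x1] := x01 i.
  by split=> //; rewrite /b ?lt_min ?x1 ?ltrDl ?e0 ?ge_min ?lexx ?orbT.
have := torus_measure_open_box_gt0 ab.
suff : (torus_measure n (open_box a b) <= 0)%E by rewrite leNgt => /negP.
rewrite -N0; apply: le_measure; rewrite ?inE//; first exact: measurable_open_box.
move=> t tab; apply: hN => /= /eqP; rewrite -subr_eq0; apply/negP.
apply: he; split => // i j; rewrite ord1 mxE /ball/= distrC ltr_distlC.
have /andP[h1 h2] := tab j.
have h3 : tnth t j < x 0 j + e.
  by apply: (lt_le_trans h2); rewrite /b ge_min lexx.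
by rewrite ltrBlDr h3/=; apply: (lt_trans h1); rewrite ltrDl.
Qed.

End torus_measure_boxes.

Section eigenfunctions.
Context {R : realType} {n : nat}.
Variable Zhat : set 'rV[int]_n.
Local Notation phi := (@eigenfun R n Zhat).

(** The true bound [sqrt 2] is rounded up; this is the factor 2 in the tail estimates for the
    Fourier series. *)
Lemma eigenfun_le2 z x : `|phi z x| <= 2.
Proof.
have s2 : Num.sqrt 2 <= 2 :> R.
  by rewrite -(@ler_pXn2r _ 2%N) ?nnegrE ?sqrtr_ge0// sqr_sqrtr//; lra.
have s0 := sqrtr_ge0 (2 : R).
rewrite /eigenfun; case: ifP => _; first by rewrite normr1 ler1n.
case: ifP => _; rewrite normrM ger0_norm//.
  by have := cos_max (2 * pi * lattice_dot z x);
    have := normr_ge0 (cos (2 * pi * lattice_dot z x)); nra.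
by have := sin_max (2 * pi * lattice_dot z x);
  have := normr_ge0 (sin (2 * pi * lattice_dot z x)); nra.
Qed.

Lemma continuous_eigenfun z : continuous (phi z).
Proof.
have cs : continuous (fun x : 'rV[R]_n => lattice_dot z x).
  move=> y; apply: (@cvg_sum_seq _ _ _ (nbhs y) _ _
    (fun k (x : 'rV[R]_n) => (z 0 k)%:~R * x 0 k)) => k.
  exact: (cvgM (cvg_cst _) (@coord_continuous R 1 n 0 k y)).
have cd : continuous (fun x : 'rV[R]_n => 2 * pi * lattice_dot z x).
  by move=> x; exact: (cvgM (cvg_cst _) (cs x)).
move=> x; rewrite /eigenfun; case: (z == 0); first exact: cst_continuous.
case: (z \in Zhat).
  exact: (cvgM (cvg_cst _) (continuous_comp (cd x) (@continuous_cos R _))).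
exact: (cvgM (cvg_cst _) (continuous_comp (cd x) (@continuous_sin R _))).
Qed.

Lemma measurable_eigenfun z :
  measurable_fun setT (fun t : n.-tuple (measurableTypeR R) => phi z (row_of_tuple t)).
Proof.
have md : measurable_fun setT (fun t : n.-tuple (measurableTypeR R) =>
    2 * pi * lattice_dot z (row_of_tuple t) : R).
  apply: measurable_funM => //; apply: measurable_sum => k.
  apply: measurable_funM => //.
  under eq_fun do rewrite mxE.
  exact: measurable_tnth.
rewrite /eigenfun; case: (z == 0) => //.
case: (z \in Zhat); apply: measurable_funM => //.
  by apply: measurableT_comp md; exact: continuous_measurable_fun (@continuous_cos R).
by apply: measurableT_comp md; exact: continuous_measurable_fun (@continuous_sin R).
Qed.

Lemma periodic_eigenfun z : Defs.periodic (phi z).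
Proof.
move=> x m; have [k hk] : exists k : int, 2 * pi * lattice_dot z (x + map_mx intr m) =
    2 * pi * lattice_dot z x + 2 * pi * k%:~R.
  exists (\sum_i z 0 i * m 0 i); rewrite -mulrDr; congr (_ * _).
  rewrite /lattice_dot rmorph_sum/= -big_split/=; apply: eq_bigr => i _.
  by rewrite !mxE intrM mulrDr.
by rewrite /eigenfun hk cos_add2piz sin_add2piz.
Qed.

Variables (alpha : 'rV[int]_n -> R) (M0 : R).
Hypothesis alphaM : tail_le alpha fset0 M0.

Definition fourier_sum (x : 'rV[R]_n) : R := sum_all (fun z => alpha z * phi z x).

Lemma fourier_tail A M x : tail_le alpha A M ->
  tail_le (fun z => alpha z * phi z x) A (M * 2).
Proof.
move=> tA B AB; apply: (@le_trans _ _ (\sum_(z <- B) `|alpha z| * 2)).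
  by apply: ler_sum => z _; rewrite normrM ler_wpM2l// eigenfun_le2.
by rewrite -big_distrl/= ler_wpM2r// tA.
Qed.

Lemma fourier_sum_tail A M x : tail_le alpha A M ->
  `|fourier_sum x - \sum_(z <- A) alpha z * phi z x| <= M * 2.
Proof.
move=> tA; exact: sum_all_tail (fourier_tail x alphaM) (fourier_tail x tA).
Qed.

Lemma continuous_fourier_sum : continuous fourier_sum.
Proof.
move=> x; apply/(cvgrPdist_lt (F := nbhs x)) => e e0.
(* Two tails of at most [2 * (e/8)] each, plus less than [e/2] for the finite sum, stay below
   [e]. *)
have [A tA] := tail_le_small alphaM (divr_gt0 e0 (@ltr0n R 8)).
have cS : continuous (fun x => \sum_(z <- A) alpha z * phi z x).
  move=> y; apply: (@cvg_sum_seq _ _ _ (nbhs y) _ _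
    (fun z x => alpha z * phi z x)) => z.
  exact: (cvgM (cvg_cst _) (@continuous_eigenfun z y)).
have /(cvgrPdist_lt (F := nbhs x))/(_ _ (divr_gt0 e0 (@ltr0n R 2))) := cS x.
apply: filterS => y; have := fourier_sum_tail x tA; have := fourier_sum_tail y tA.
rewrite !ler_norml !ltr_norml => /andP[h1 h2] /andP[h3 h4] /andP[h5 h6].
apply/andP; split; lra.
Qed.

Lemma periodic_fourier_sum : Defs.periodic fourier_sum.
Proof.
move=> x m; rewrite /fourier_sum; congr sum_all; apply/funext => z.
by rewrite periodic_eigenfun.
Qed.

Lemma measurable_fourier_sum :
  measurable_fun setT (fun t : n.-tuple (measurableTypeR R) =>
    fourier_sum (row_of_tuple t)).
Proof.
apply: (measurable_fun_cvg (h := fun N t =>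
    \sum_(z <- enum_upto N) alpha z * phi z (row_of_tuple t))).
  move=> N; apply: measurable_sum => z; apply: measurable_funM => //.
  exact: measurable_eigenfun.
by move=> t _; exact: cvg_sum_all (fourier_tail _ alphaM).
Qed.

End eigenfunctions.

Lemma Lnorm2_bounded d (T : measurableType d) (R : realType)
    (P : probability T R) (f : T -> R) (M : R) : measurable_fun setT f ->
  (forall t, `|f t| <= M) -> ('N[P]_2%:E[(fun t => (f t)%:E)] <= M%:E)%E.
Proof.
move=> mf fM; have [t0|T0] := pselect (exists t : T, True); last first.
  have := @probability_setT _ _ _ P; rewrite (_ : setT = set0) ?measure0.
    by move=> [/eqP]; rewrite eq_sym oner_eq0.
  by apply/seteqP; split=> // t _; apply: T0; exists t.
have M0 : 0 <= M by case: t0 => t _; apply: le_trans (fM t).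
apply/Lnorm2_leP => //.
apply: (@le_trans _ _ (\int[P]_t (M ^+ 2)%:E)%E).
  apply: ge0_le_integral => //.
  - by move=> t _; rewrite lee_fin sqr_ge0.
  - by apply/measurable_EFinP; exact: measurable_funX.
  - by move=> t _; rewrite lee_fin -[leLHS]real_normK ?num_real// lerXn2r ?nnegrE.
rewrite integral_cst//.
by rewrite -[leRHS]mule1; apply: lee_pmul; rewrite ?lee_fin ?sqr_ge0// probability_le1.
Qed.

(** * Identification of the continuous version with the Fourier series *)

Section continuous_version.
Context {R : realType} {n : nat}.
Variables (Zhat : set 'rV[int]_n) (alpha : 'rV[int]_n -> R) (M0 : R).
Hypothesis alphaM : tail_le alpha fset0 M0.
Local Notation G := (fourier_sum Zhat alpha).
Variable f : 'rV[R]_n -> R.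
Hypothesis f_sum : is_L2_sum (torus_measure n) setT
  (fun z t => alpha z * eigenfun Zhat z (row_of_tuple t)) (f \o @row_of_tuple R n).

(** [G] uniformly and [f] in L^2 are both close to the partial sum over one large finite set [C], so
    their L^2 distance is below every positive [e]. *)
Lemma fourier_sum_ae :
  {ae torus_measure n, forall t, G (row_of_tuple t) = f (row_of_tuple t)}.
Proof.
have [mf hf] := f_sum; have mG := measurable_fourier_sum Zhat alphaM.
have mS (B : {fset 'rV[int]_n}) : measurable_fun setT
    (fun t : n.-tuple (measurableTypeR R) =>
      \sum_(z <- B) alpha z * eigenfun Zhat z (row_of_tuple t)).
  apply: measurable_sum => z; apply: measurable_funM => //.
  exact: measurable_eigenfun.
have small e : 0 < e -> ('N[torus_measure n]_2%:E[
    (fun t => (G (row_of_tuple t) - f (row_of_tuple t))%:E)] <= e%:E)%E.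
  move=> e0; have [A tA] := tail_le_small alphaM (divr_gt0 e0 (@ltr0n R 4)).
  have [B [finB _] hB] := hf _ (divr_gt0 e0 (@ltr0n R 2)).
  pose C := (A `|` fset_set B)%fset.
  have tC : tail_le alpha C (e / 4) by apply: tail_leS tA; exact: fsubsetUl.
  have hC : ('N[torus_measure n]_2%:E[(fun t => (f (row_of_tuple t) -
      \sum_(z <- C) alpha z * eigenfun Zhat z (row_of_tuple t))%:E)] <= (e / 2)%:E)%E.
    rewrite (eq_Lnorm _ _ (g := fun t => ((f \o @row_of_tuple R n) t -
      \sum_(z \in [set` C]) alpha z * eigenfun Zhat z (row_of_tuple t))%:E)).
      apply/ltW/hB; first by split=> //; exact: finite_fset.
      by move=> z Bz; rewrite /C/= !inE in_fset_set// mem_set// orbT.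
    by move=> t; rewrite fsbig_fset.
  rewrite (_ : e = e / 4 * 2 + e / 2); last by field.
  rewrite (eq_Lnorm _ _ (g := fun t =>
    ((G (row_of_tuple t) - \sum_(z <- C) alpha z * eigenfun Zhat z (row_of_tuple t)) +
     - (f (row_of_tuple t) -
        \sum_(z <- C) alpha z * eigenfun Zhat z (row_of_tuple t)))%:E)); last first.
    by move=> t; congr EFin; ring.
  apply: Lnorm2D.
  - exact: measurable_funB.
  - by apply: measurableT_comp => //; exact: measurable_funB.
  - apply: Lnorm2_bounded; first exact: measurable_funB.
    by move=> t; exact: (fourier_sum_tail _ alphaM _ tC).
  - by rewrite Lnorm2N.
have : ('N[torus_measure n]_2%:E[
    (fun t => (G (row_of_tuple t) - f (row_of_tuple t))%:E)] = 0)%E.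
  apply/eqP; rewrite eq_le Lnorm_ge0 andbT; apply/lee_addgt0Pr => e e0.
  by rewrite add0e small.
have mGf : measurable_fun setT (fun t : n.-tuple (measurableTypeR R) =>
    (G (row_of_tuple t) - f (row_of_tuple t))%:E).
  by apply/measurable_EFinP; exact: measurable_funB.
move=> /(Lnorm_eq0_eq0 mGf); rewrite lte_fin => /(_ (ltr0n _ 2)).
apply: filterS => t /= /(_ Logic.I) [] /eqP; rewrite subr_eq0 => /eqP.
exact.
Qed.

(** [G] is itself a candidate, which excludes the default value; any other candidate agrees with it
    on the half-open cube, where the sample points [j / L] lie. *)
Lemma continuous_versionE (x : 'rV[R]_n) : (forall i, 0 <= x 0 i < 1) ->
  continuous_version f x = G x.
Proof.
move=> x01; rewrite /continuous_version; case: xgetP => [g _ [_ cg gf]|h].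
  apply: continuous_eq_ae x01 => //; first exact: continuous_fourier_sum alphaM.
  have h := fourier_sum_ae; near=> t.
  by transitivity (f (row_of_tuple t)); [near: t|symmetry; near: t].
exfalso; apply: (h G); split.
- exact: periodic_fourier_sum.
- exact: continuous_fourier_sum alphaM.
- exact: fourier_sum_ae.
Unshelve. all: by end_near. Qed.

End continuous_version.

(** * Eigenvalues *)

Section eigenvalues.
Context {R : realType}.

(** By the mean value theorem [sin x = x cos c] with [0 < c < x], and cosine decreases there. *)
Lemma sin_bounds (x : R) : 0 <= x -> x <= pi / 2 -> x * cos x <= sin x <= x.
Proof.
rewrite le_eqVlt => /orP[/eqP<-|x0] xpi; first by rewrite mul0r sin0 lexx.
have [c] := @MVT R sin cos 0 x x0 (fun y _ => is_derive_sin y)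
  (continuous_subspaceT (@continuous_sin R)).
rewrite in_itv/= => /andP[c0 cx]; rewrite sin0 !subr0 mulrC => ->.
rewrite ler_pM2l// ler_piMr ?(ltW x0) ?cos_le1// andbT ltW//.
by rewrite ltr_cos ?in_itv/= ?(ltW x0) ?(ltW c0)//=; have := @pi_ge2 R; lra.
Qed.

(** Put [y = x/2]. Then [sin x = 2 sin y cos y >= 2 y cos^2 y], and [2 cos^2 y = 1 + cos x >= 1]. *)
Lemma sin_ge_half (x : R) : 0 <= x -> x <= pi / 2 -> x / 2 <= sin x.
Proof.
move=> x0 xpi.
have -> : sin x = sin ((x / 2) *+ 2) by congr sin; rewrite mulr2n; lra.
have p2 := @pi_ge2 R.
have /andP[h _] : x / 2 * cos (x / 2) <= sin (x / 2) <= x / 2.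
  by apply: sin_bounds; lra.
have c0 : 0 <= cos x by rewrite cos_ge0_pihalf//; apply/andP; split; lra.
have : cos x = 2 * cos (x / 2) ^+ 2 - 1.
  by rewrite mulr_natl -cos_mulr2n; congr cos; rewrite mulr2n; lra.
have h0 : 0 <= cos (x / 2) by rewrite cos_ge0_pihalf//; apply/andP; split; lra.
rewrite sin_mulr2n [leRHS]mulr2n; move: h c0 h0; move: (cos _) (sin _) (cos x) => a b c.
move=> ab c0 a0 ca.
have h1 := ler_wpM2l a0 ab; have h2 := mulr_ge0 x0 c0; rewrite ca in h2.
by nra.
Qed.

Lemma cvg_mul_sin_div (a : R) : 0 <= a ->
  L%:R * sin (a / L%:R) @[L --> \oo] --> a.
Proof.
move=> a0.
have aL : a / L%:R @[L --> \oo] --> (0 : R).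
  rewrite -[X in _ --> X](mulr0 a); apply: cvgM; first exact: cvg_cst.
  apply/(@cvgrPdist_lt _ R^o) => e e0; near=> L.
  have L0 : (0 : R) < L%:R by near: L; exact: nbhs_infty_gtr.
  rewrite sub0r normrN gtr0_norm ?invr_gt0// invf_plt ?posrE//.
  by near: L; exact: nbhs_infty_gtr.
apply: (@squeeze_cvgr _ _ _ _ (fun L => a * cos (a / L%:R)) (fun=> a)).
- near=> L.
  have L0 : (0 : R) < L%:R by near: L; exact: nbhs_infty_gtr.
  have p2 := @pi_ge2 R.
  have /andP[h1 h2] : a / L%:R * cos (a / L%:R) <= sin (a / L%:R) <= a / L%:R.
    apply: sin_bounds; first by rewrite divr_ge0// ltW.
    rewrite ler_pdivrMr//; apply: (@le_trans _ _ (1 * L%:R)).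
      by rewrite mul1r ltW//; near: L; exact: nbhs_infty_gtr.
    by rewrite ler_pM2r//; lra.
  apply/andP; split.
    rewrite (_ : a * _ = L%:R * (a / L%:R * cos (a / L%:R))).
      by rewrite ler_pM2l.
    by field; rewrite gt_eqF.
  by rewrite mulrC -ler_pdivlMr.
- have h : a * cos (a / L%:R) @[L --> \oo] --> a * cos 0.
    apply: cvgM; first exact: cvg_cst.
    by apply: (cvg_comp _ _ aL); exact: continuous_cos.
  by rewrite cos0 mulr1 in h.
- exact: cvg_cst.
Unshelve. all: by end_near. Qed.

(** Since the squared sine is even, absolute values can be inserted; this makes the arguments
    nonnegative, as the sine estimates require. *)
Lemma discrete_eigenvalE (n L : nat) (z : 'rV[int]_n) :
  discrete_eigenval L z =
  \sum_k 4 * (L%:R * sin (pi * `|z 0 k|%:~R / L%:R)) ^+ 2 :> R.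
Proof.
rewrite /discrete_eigenval big_distrr/=; apply: eq_bigr => k _.
have e : sin (pi * `|z 0 k|%:~R / L%:R) ^+ 2 =
    sin (pi * (z 0 k)%:~R / L%:R) ^+ 2 :> R.
  have [m0|m0] := lerP 0 (z 0 k); first by rewrite ger0_norm.
  by rewrite ltr0_norm// mulrNz mulrN mulNr sinN sqrrN.
by rewrite exprMn e; ring.
Qed.

Lemma eigenvalE (n : nat) (z : 'rV[int]_n) :
  eigenval z = \sum_k 4 * (pi * `|z 0 k|%:~R) ^+ 2 :> R.
Proof.
rewrite /eigenval exprMn sqr_sqrtr ?sumr_ge0// => [|k _]; last exact: sqr_ge0.
rewrite big_distrr/=; apply: eq_bigr => k _.
by rewrite intr_norm !exprMn real_normK ?num_real//; ring.
Qed.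

Lemma cvg_discrete_eigenval (n : nat) (z : 'rV[int]_n) :
  discrete_eigenval L z @[L --> \oo] --> (eigenval z : R).
Proof.
rewrite eigenvalE (_ : (fun L => discrete_eigenval L z) = fun L =>
    \sum_k 4 * (L%:R * sin (pi * `|z 0 k|%:~R / L%:R)) ^+ 2 :> R); last first.
  by apply/funext => L; exact: discrete_eigenvalE.
apply: cvg_sum_seq => k.
have h : L%:R * sin (pi * `|z 0 k|%:~R / L%:R) @[L --> \oo] -->
    (pi * `|z 0 k|%:~R : R).
  by apply: cvg_mul_sin_div; rewrite mulr_ge0 ?pi_ge0// ler0z.
exact: cvgM (cvg_cst _) (cvgM h h).
Qed.

Lemma eigenval_ge1 (n : nat) (z : 'rV[int]_n) : z != 0 -> 1 <= eigenval z :> R.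
Proof.
move=> z0; have h1 := lattice_norm_ge1 (R := R) z0; have p2 := @pi_ge2 R.
have h : 1 <= 2 * pi * lattice_norm z :> R by nra.
by rewrite /eigenval expr_ge1// (le_trans ler01).
Qed.

(** One nonzero coordinate suffices. With [1 <= m < L/2] its absolute value, the angle [pi m / L] is
    below [pi/2], and [sin_ge_half] gives [L sin(pi m / L) >= pi m / 2 >= 1], uniformly in [L]. *)
Lemma discrete_eigenval_ge1 (n L : nat) (z : 'rV[int]_n) :
  (0 < L)%N -> @discrete_lattice R n L z -> z != 0 -> 1 <= discrete_eigenval L z :> R.
Proof.
move=> L0 zL z0; have LR : (0 : R) < L%:R by rewrite ltr0n.
have [k zk] : exists k, z 0 k != 0.
  apply/existsP; apply: contraR z0; rewrite negb_exists => /forallP h.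
  by apply/eqP/rowP => k; rewrite mxE; apply/eqP/negPn.
rewrite discrete_eigenvalE (bigD1 k)//=.
apply: (@le_trans _ _ (4 * (L%:R * sin (pi * `|z 0 k|%:~R / L%:R)) ^+ 2)); last first.
  by rewrite lerDl sumr_ge0// => i _; rewrite mulr_ge0 ?sqr_ge0.
have m1 : 1 <= `|z 0 k|%:~R :> R by rewrite ler1z -gtz0_ge1 normr_gt0.
have mL : `|z 0 k|%:~R < L%:R / 2 :> R := zL k.
move: m1 mL; move: (`|z 0 k|%:~R : R) => m m1 mL.
have p2 := @pi_ge2 R.
have : pi * m / L%:R / 2 <= sin (pi * m / L%:R).
  apply: sin_ge_half; first by rewrite divr_ge0 ?(ltW LR)// mulr_ge0//; lra.
  by rewrite ler_pdivrMr//; nra.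
have e : L%:R * (pi * m / L%:R / 2) = pi * m / 2 by field; rewrite gt_eqF.
rewrite -(ler_pM2l LR) e.
move: (L%:R * _) => x hx; have : 1 <= x by nra.
by nra.
Qed.

Lemma powRN_le1 (x r : R) : 1 <= x -> 0 <= r -> x `^ (- r) <= 1.
Proof.
move=> x1 r0; rewrite powRN invf_le1 ?powR_gt0 ?(lt_le_trans ltr01)//.
have h : (1 : R) `^ r <= x `^ r.
  by rewrite ge0_ler_powR ?nnegrE ?ler01// (le_trans ler01).
by rewrite powR1 in h.
Qed.

(** [powR] is defined by cases at 0; a positive limit keeps [u L] eventually in the exponential
    branch, which is continuous. *)
Lemma cvg_powR (F : set_system nat) (FF : Filter F) (u : nat -> R) (l r : R) :
  0 < l -> u L @[L --> F] --> l -> u L `^ r @[L --> F] --> l `^ r.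
Proof.
move=> l0 ul.
have -> : l `^ r = expR (r * ln l) by rewrite /powR gt_eqF.
have h : expR (r * ln (u L)) @[L --> F] --> expR (r * ln l).
  apply: continuous_cvg; first exact: continuous_expR.
  apply: cvgM; first exact: cvg_cst.
  by apply: continuous_cvg ul; exact: continuous_ln.
apply: cvg_trans h; apply: near_eq_cvg.
near=> L; rewrite /powR gt_eqF//.
by near: L; apply: (cvgr_gt l ul).
Unshelve. all: by end_near. Qed.

Lemma finite_discrete_lattice (n L : nat) : finite_set (@discrete_lattice R n L).
Proof.
pose h (f : {ffun 'I_n -> bool * 'I_L.+1}) : 'rV[int]_n :=
  \row_k (if (f k).1 then - ((f k).2 : nat)%:Z else ((f k).2 : nat)%:Z).
apply: (@sub_finite_set _ _ (h @` setT)); last first.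
  by apply: finite_image; exact: finite_finset.
move=> z zL; exists [ffun k => (z 0 k < 0, inord `|z 0%R k|%N)] => //.
apply/rowP => k; rewrite mxE ffunE /= inordK; first by case: ifPn; lia.
have := zL k; rewrite ltr_pdivlMr// -[L%:R]/(L%:Z%:~R) mulr_natr -rmorphMn/= ltr_int.
by rewrite mulr2n; lia.
Qed.

Lemma discrete_lattice_exhaust (n : nat) (A : {fset 'rV[int]_n}) :
  \forall L \near \oo, forall z, z \in A -> @discrete_lattice R n L z.
Proof.
pose N := (\max_(z <- A) \max_(k < n) `|z 0%R k|)%N.
exists (N.*2.+1) => // L /= NL z zA k.
have hN : (`|z 0%R k| <= N)%N.
  apply: leq_trans (@leq_bigmax_seq _ _ _ (fun z : 'rV[int]_n =>
    \max_(k < n) `|z 0%R k|)%N _ zA isT).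
  exact: (@leq_bigmax _ (fun k => `|z 0%R k|)%N).
rewrite ltr_pdivlMr// -[L%:R]/(L%:Z%:~R) mulr_natr -rmorphMn/= ltr_int.
by rewrite mulr2n; lia.
Qed.

End eigenvalues.

(** * Aliasing *)

Section pairing_linearity.
Context {R : realType} {n : nat}.
Variable L' : nat.
Local Notation L := L'.+1.
Implicit Types f g : 'rV[R]_n -> R.

(** The points [j / L] with [j < L] all lie in the half-open cube. *)
Lemma discrete_pairing_eqr f g1 g2 :
  (forall x : 'rV[R]_n, (forall i, 0 <= x 0 i < 1) -> g1 x = g2 x) ->
  discrete_pairing L f g1 = discrete_pairing L f g2.
Proof.
move=> g12; congr (_ * _); apply: eq_bigr => j _; rewrite g12// => i.
by rewrite mxE divr_ge0//= ltr_pdivrMr ?ltr0n// mul1r ltr_nat.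
Qed.

Lemma discrete_pairingDr f g1 g2 :
  discrete_pairing L f (fun x => g1 x + g2 x) =
  discrete_pairing L f g1 + discrete_pairing L f g2.
Proof.
rewrite /discrete_pairing -mulrDr -big_split; congr (_ * _).
by apply: eq_bigr => j _ /=; rewrite mulrDr.
Qed.

Lemma discrete_pairing_sumr (I : Type) (s : seq I) f (a : I -> R)
    (g : I -> 'rV[R]_n -> R) :
  discrete_pairing L f (fun x => \sum_(i <- s) a i * g i x) =
  \sum_(i <- s) a i * discrete_pairing L f (g i).
Proof.
rewrite /discrete_pairing big_distrr/= [RHS](eq_bigr (fun i =>
    \sum_(j : 'rV['I_L]_n) (L%:R ^+ n)^-1 *
      (f (discrete_torus_pt j) * (a i * g i (discrete_torus_pt j))))).
  by rewrite exchange_big; apply: eq_bigr => j _; rewrite !big_distrr.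
move=> i _; rewrite mulrCA !big_distrr/=; apply: eq_bigr => j _; ring.
Qed.

Lemma discrete_pairing_suml (I : Type) (s : seq I) g (a : I -> R)
    (f : I -> 'rV[R]_n -> R) :
  discrete_pairing L (fun x => \sum_(i <- s) a i * f i x) g =
  \sum_(i <- s) a i * discrete_pairing L (f i) g.
Proof.
have sym f1 f2 : discrete_pairing L f1 f2 = discrete_pairing L f2 f1.
  by congr (_ * _); apply: eq_bigr => j _; rewrite mulrC.
by rewrite sym discrete_pairing_sumr; apply: eq_bigr => i _; rewrite sym.
Qed.

Lemma discrete_pairing_le f g (a b : R) :
  (forall x, `|f x| <= a) -> (forall x, `|g x| <= b) ->
  `|discrete_pairing L f g| <= a * b.
Proof.
move=> fa gb; have Ln : 0 < L%:R ^+ n :> R by rewrite exprn_gt0// ltr0n.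
rewrite /discrete_pairing normrM ger0_norm ?invr_ge0 ?(ltW Ln)//.
rewrite mulrC ler_pdivrMr// (le_trans (ler_norm_sum _ _ _))//.
apply: (@le_trans _ _ (\sum_(j : 'rV['I_L]_n) a * b)).
  by apply: ler_sum => j _; rewrite normrM ler_pM.
by rewrite sumr_const card_mx card_ord mul1n -natrX mulr_natr.
Qed.

End pairing_linearity.

Section aliasing.
Context {R : realType} {n : nat}.
Variable L' : nat.
Local Notation L := L'.+1.
Variables (Zhat : set 'rV[int]_n) (alpha : 'rV[int]_n -> R) (M0 : R).
Hypothesis Zhat_half : half_lattice Zhat.
Hypothesis alphaM : tail_le alpha fset0 M0.
Local Notation phi := (@eigenfun R n Zhat).
Local Notation ZL := (@discrete_lattice R n L).

(* Expand the Fourier sum over a large finite set [D]: frequencies in [A] are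
   reproduced exactly by orthonormality, each other frequency [w] contributes
   at most [2 * |alpha w|] in l^1 by the aliasing bound. *)
Lemma fourier_aliasing_le (A Z : {fset 'rV[int]_n}) (e : R) :
  (forall w, w \in A -> ZL w) -> tail_le alpha A e ->
  (forall z, z \in Z -> z != 0 /\ ZL z) ->
  \sum_(z <- Z) `|discrete_pairing L (phi z) (fourier_sum Zhat alpha) -
                  (if z \in A then alpha z else 0)| <= e * 2.
Proof.
move=> AZ tA hZ; apply/ler_addgt0Pr => d d0.
pose m : R := (size (enum_fset Z))%:R + 1.
have m0 : 0 < m by rewrite ltr_wpDl.
(* The remainder [r] costs at most [2 * (dl * 2)] for each of at most [m] elements of [Z], from
   [|phi z| <= 2] and [|r| <= dl * 2]; the total is [d]. The [+ 1] in [m] keeps it positive for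
   empty [Z]. *)
pose dl := d / (4 * m).
have dl0 : 0 < dl by rewrite divr_gt0// mulr_gt0.
have [D1 tD1] := tail_le_small alphaM dl0.
pose D := (A `|` D1)%fset.
have AD : (A `<=` D)%fset by exact: fsubsetUl.
have tD : tail_le alpha D dl by apply: tail_leS tD1; exact: fsubsetUr.
pose r x := fourier_sum Zhat alpha x - \sum_(w <- D) alpha w * phi w x.
have rle x : `|r x| <= dl * 2 := fourier_sum_tail Zhat alphaM x tD.
have bE z : z \in Z ->
    `|discrete_pairing L (phi z) (fourier_sum Zhat alpha) -
      (if z \in A then alpha z else 0)| <=
    \sum_(w <- (D `\` A)%fset) `|alpha w| * `|discrete_pairing L (phi z) (phi w)| +
    2 * (dl * 2).
  move=> /hZ[z0 zL].
  rewrite (@discrete_pairing_eqr _ _ L' _ _ (fun x =>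
    \sum_(w <- D) alpha w * phi w x + r x)); last first.
    by move=> x _; rewrite /r addrC subrK.
  rewrite discrete_pairingDr discrete_pairing_sumr (sum_fsetD _ AD).
  have -> : \sum_(w <- A) alpha w * discrete_pairing L (phi z) (phi w) =
      if z \in A then alpha z else 0.
    transitivity (\sum_(w <- A) alpha w * (z == w)%:R).
      apply: eq_fbigr => w wA _; rewrite pairing_orthonormal//; exact: AZ.
    case: ifPn => zA.
      rewrite (big_fsetD1 z)//= eqxx mulr1 big1_fset ?addr0// => w.
      by rewrite !inE eq_sym => /andP[/negbTE -> _]; rewrite mulr0.
    rewrite big1_fset// => w wA _.
    by rewrite (_ : (z == w) = false) ?mulr0//; apply: contraNF zA => /eqP ->.
  rewrite addrAC [_ + _ - _]addrAC subrr add0r (le_trans (ler_normD _ _))// lerD//.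
    rewrite (le_trans (ler_norm_sum _ _ _))// ler_sum// => w _.
    by rewrite normrM.
  by apply: discrete_pairing_le => // x; exact: eigenfun_le2.
apply: (@le_trans _ _ (\sum_(z <- Z)
  (\sum_(w <- (D `\` A)%fset) `|alpha w| * `|discrete_pairing L (phi z) (phi w)| +
    2 * (dl * 2)))).
  by rewrite big_seq [leRHS]big_seq; apply: ler_sum => z /bE.
rewrite big_split/=; apply: lerD.
  rewrite exchange_big/=.
  apply: (@le_trans _ _ (\sum_(w <- (D `\` A)%fset) `|alpha w| * 2)).
    apply: ler_sum => w _; rewrite -big_distrr/= ler_wpM2l//.
    exact: sum_pairing_le2.
  by rewrite -big_distrl/= ler_wpM2r// tA// fdisjoint_fsetD.
rewrite big_const_seq count_predT iter_addr_0 -[leLHS]mulr_natl.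
apply: (@le_trans _ _ (m * (2 * (dl * 2)))).
  have x0 : 0 <= 2 * (dl * 2) by have := ltW dl0; lra.
  by rewrite ler_wpM2r// /m lerDl.
by rewrite le_eqVlt; apply/orP; left; apply/eqP; rewrite /dl; field; rewrite gt_eqF.
Qed.

End aliasing.

(** * Convergence of the fields *)

Section fields.
Context {R : realType} {d : measure_display} {Omega : measurableType d}.
Variables (P : probability Omega R) (n : nat).
Variables (Zhat : set 'rV[int]_n) (Zhat_half : half_lattice Zhat).
Variables (xi : 'rV[int]_n -> {RV P >-> R}) (alpha : 'rV[int]_n -> R) (M0 K : R).
Hypothesis alphaM : tail_le alpha fset0 M0.
Hypothesis K0 : 0 <= K.
Hypothesis xiK : forall z, z != 0 -> ('N[P]_2%:E[(fun w => (xi z w)%:E)] <= K%:E)%E.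
Local Notation phi := (@eigenfun R n Zhat).

Definition eigen_weight (z : 'rV[int]_n) : R := eigenval z `^ (- (n%:R / 4)).

Definition discrete_weight L (z : 'rV[int]_n) : R :=
  discrete_eigenval L z `^ (- (n%:R / 4)).

Let n4 : 0 <= n%:R / 4 :> R. Proof. by rewrite divr_ge0. Qed.

Lemma eigen_weight_norm_le1 z : z != 0 -> `|eigen_weight z| <= 1.
Proof.
by move=> z0; rewrite ger0_norm ?powR_ge0// powRN_le1// eigenval_ge1.
Qed.

Lemma discrete_weight_norm_le1 L z : (0 < L)%N -> @discrete_lattice R n L z ->
  z != 0 -> `|discrete_weight L z| <= 1.
Proof.
move=> L0 zL z0; rewrite ger0_norm ?powR_ge0// powRN_le1//.
exact: discrete_eigenval_ge1.
Qed.

Lemma cvg_discrete_weight z : z != 0 ->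
  discrete_weight L z @[L --> \oo] --> eigen_weight z.
Proof.
move=> z0; apply: cvg_powR; last exact: cvg_discrete_eigenval.
by rewrite (lt_le_trans ltr01)// eigenval_ge1.
Qed.

Lemma discrete_pairing_field L' w g (L := L'.+1) :
  discrete_pairing L (discrete_field Zhat xi L w) g =
  @field_const R n `^ (- 2^-1) *
  \sum_(z <- fset_set (@discrete_lattice R n L `\ 0))
    discrete_weight L z * xi z w * discrete_pairing L (phi z) g.
Proof.
rewrite -discrete_pairing_suml /discrete_field.
rewrite /discrete_pairing mulrCA; congr (_ * _).
rewrite big_distrr/=; apply: eq_bigr => j _.
rewrite fsbig_finite ?mulrA//; apply: finite_setD.
exact: finite_discrete_lattice.
Qed.

Local Notation u := (fun z w => eigen_weight z * xi z w * alpha z).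

(** The weights are at most 1, so [K * |alpha z|] bounds the norms of the terms and is summable: a
    sum exists, and [xget] returns one. *)
Lemma is_L2_sum_field :
  is_L2_sum P [set z | z != 0] u (L2_sum P [set z | z != 0] u).
Proof.
have [g hg] : exists g, is_L2_sum P [set z | z != 0] u g.
  apply: (@is_L2_sum_exists _ _ _ _ _ _ _ (fun z => `|K * alpha z|) (K * M0)).
  - by move=> z _; apply: measurable_funM => //; apply: measurable_funM.
  - move=> z z0; split=> //.
    rewrite (eq_Lnorm _ _ (g := fun w => ((eigen_weight z * alpha z) * xi z w)%:E)).
      apply: le_trans (Lnorm2_scale _ _ K0 (xiK z0)) _ => //.
      rewrite lee_fin !normrM (ger0_norm K0) (mulrC K) -mulrA ler_piMl ?mulr_ge0//.
      exact: eigen_weight_norm_le1.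
    by move=> w; congr EFin; ring.
  - move=> B _; under eq_bigr do rewrite normr_id normrM (ger0_norm K0).
    by rewrite -big_distrr/= ler_wpM2l// tail_le_bound.
have := xgetPex (fun=> 0)
  (ex_intro [set g | is_L2_sum P [set z | z != 0] u g] g hg).
exact.
Qed.

Lemma field_error_le (e : R) : 0 < e -> \forall L \near \oo,
  ('N[P]_2%:E[(fun w => (discrete_pairing L (discrete_field Zhat xi L w)
      (fourier_sum Zhat alpha) - field_pairing xi alpha w)%:E)] <=
   (`|@field_const R n `^ (- 2^-1)| * (e * K + e * 2 * K + e))%:E)%E.
Proof.
move=> e0; set C := @field_const R n `^ _.
have [mX hX] := is_L2_sum_field.
set X := L2_sum _ _ _ in mX hX.
have fpE w : field_pairing xi alpha w = C * X w by [].
have [A2 [finA2 A2n0] hA2] := hX _ e0.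
have [A1 tA1] := tail_le_small alphaM e0.
(* [A0] keeps the zero frequency for the aliasing bound on [f]; [A] drops it, as the fields have no
   zero mode. *)
pose A0 := (0 |` (A1 `|` fset_set A2))%fset.
pose A := (A0 `\ 0)%fset.
have tA0 : tail_le alpha A0 e.
  by apply: tail_leS tA1; apply/fsubsetP => z zA; rewrite !inE zA orbT.
have An0 z : z \in A -> z != 0 by rewrite !inE => /andP[].
have NX : ('N[P]_2%:E[(fun w => (X w - \sum_(z <- A) u z w)%:E)] <= e%:E)%E.
  rewrite (eq_Lnorm _ _ (g := fun w => (X w - \sum_(z \in [set` A]) u z w)%:E)).
    apply/ltW/hA2; first by split=> [|z /An0 //]; exact: finite_fset.
    move=> z A2z; rewrite /A /A0 /= !inE in_fset_set// mem_set// !orbT andbT.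
    exact: A2n0.
  by move=> w; rewrite fsbig_fset.
pose dL L := \sum_(z <- A) `|discrete_weight L z - eigen_weight z| * `|alpha z|.
have dL0 : dL L @[L --> \oo] --> (0 : R).
  (* [cvg_sum_seq] asks for a limit at every index, while the weights are known to converge only for
     [z] nonzero; [A] avoids 0, so the value there is free. *)
  pose f z L : R := if z == 0 then 0 else
    `|discrete_weight L z - eigen_weight z| * `|alpha z|.
  have -> : dL = fun L => \sum_(z <- A) f z L.
    apply/funext => L; apply: eq_fbigr => z /An0 z0 _.
    by rewrite /f (negbTE z0).
  have f0 z : f z L @[L --> \oo] --> (0 : R).
    rewrite /f; have [_|z0] := eqVneq z 0; first exact: cvg_cst.
    have h : `|discrete_weight L z - eigen_weight z| * `|alpha z| @[L --> \oo] -->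
        `|eigen_weight z - eigen_weight z| * `|alpha z|.
      apply: cvgM; last exact: cvg_cst.
      apply: cvg_norm; apply: cvgB; last exact: cvg_cst.
      exact: cvg_discrete_weight.
    by rewrite subrr normr0 mul0r in h.
  have h := @cvg_sum_seq R nat _ \oo _ (enum_fset A) f (fun=> 0) f0.
  have {}h := h _; rewrite (big1_eq (R := R)) in h.
  exact: h.
have L_gt0 : \forall L \near \oo, (0 < L)%N by exact: nbhs_infty_gt.
have L_A0 := @discrete_lattice_exhaust R n A0.
have L_dL : \forall L \near \oo, dL L <= e.
  move/cvgrPdist_le : dL0 => /(_ _ e0); apply: filterS => L.
  by rewrite sub0r normrN; exact: le_trans (ler_norm _).
apply: filterS3 L_gt0 L_A0 L_dL => -[//|L'] _ A0L dLe.
set L := L'.+1 in A0L dLe *.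
pose Z := fset_set (@discrete_lattice R n L `\ 0).
have ZP z : (z \in Z) = `[< @discrete_lattice R n L z /\ z != 0 >].
  rewrite /Z in_fset_set; last by apply: finite_setD; exact: finite_discrete_lattice.
  by apply/idP/asboolP; rewrite inE => -[zL z0]; split=> //=; apply/eqP.
have hZ z : z \in Z -> z != 0 /\ @discrete_lattice R n L z.
  by rewrite ZP => /asboolP[].
have AZ : (A `<=` Z)%fset.
  apply/fsubsetP => z zA; rewrite ZP; apply/asboolP; split; last exact: An0.
  by apply: A0L; move: zA; rewrite inE => /andP[].
pose rho z := discrete_pairing L (phi z) (fourier_sum Zhat alpha) -
  (if z \in A0 then alpha z else 0).
have rho_le : \sum_(z <- Z) `|rho z| <= e * 2.
  exact: (fourier_aliasing_le Zhat_half alphaM).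
(* Three sources of error: [T1] replaces the discrete weights by their limits on [A], [T2] carries
   the aliasing residual [rho] over all of [Z], and [T3] is the tail of the limit series off [A]. *)
pose T1 w := \sum_(z <- A)
  (discrete_weight L z - eigen_weight z) * alpha z * xi z w.
pose T2 w := \sum_(z <- Z) discrete_weight L z * rho z * xi z w.
pose T3 w := - (X w - \sum_(z <- A) u z w).
have mT1 : measurable_fun setT T1.
  by apply: measurable_sum => z; exact: measurable_funM.
have mT2 : measurable_fun setT T2.
  by apply: measurable_sum => z; exact: measurable_funM.
have mT3 : measurable_fun setT T3.
  apply: measurableT_comp => //; apply: measurable_funB => //.
  apply: measurable_sum => z; apply: measurable_funM => //.
  exact: measurable_funM.
rewrite (eq_Lnorm _ _ (g := fun w => (C * (T1 w + T2 w + T3 w))%:E)); last first.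
  move=> w; congr EFin; rewrite discrete_pairing_field -/C -/Z fpE -mulrBr.
  congr (_ * _); pose F z := discrete_weight L z * xi z w * alpha z.
  have hF : \sum_(z <- A) F z = \sum_(z <- Z) (if z \in A0 then F z else 0).
    rewrite -(big_fset_incl _ AZ) => [|z zZ]; last first.
      by rewrite in_fsetD1 (proj1 (hZ _ zZ)) /= => /negbTE ->.
    by apply: eq_fbigr => z; rewrite in_fsetD1 => /andP[_ ->].
  have -> : \sum_(z <- Z) discrete_weight L z * xi z w *
      discrete_pairing L (phi z) (fourier_sum Zhat alpha) =
      T2 w + \sum_(z <- A) F z.
    rewrite hF /T2 -big_split; apply: eq_bigr => z _ /=.
    by rewrite /rho /F; case: (z \in A0); ring.
  have -> : T1 w = \sum_(z <- A) F z - \sum_(z <- A) u z w.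
    by rewrite -sumrB; apply: eq_bigr => z _; rewrite /F; ring.
  by rewrite /T3; ring.
have n1 : ('N[P]_2%:E[(fun w => (T1 w)%:E)] <= (e * K)%:E)%E.
  apply: (@le_trans _ _ (\sum_(z <- A)
      `|(discrete_weight L z - eigen_weight z) * alpha z| * K)%:E).
    apply: Lnorm2_sum => z; first exact: measurable_funM.
    by move=> /An0 z0; apply: Lnorm2_scale => //; exact: xiK.
  rewrite lee_fin -big_distrl/= ler_wpM2r//.
  by under eq_bigr do rewrite normrM.
have n2 : ('N[P]_2%:E[(fun w => (T2 w)%:E)] <= (e * 2 * K)%:E)%E.
  apply: (@le_trans _ _ (\sum_(z <- Z) `|discrete_weight L z * rho z| * K)%:E).
    apply: Lnorm2_sum => z; first exact: measurable_funM.
    by move=> /hZ[z0 _]; apply: Lnorm2_scale => //; exact: xiK.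
  rewrite lee_fin -big_distrl/= ler_wpM2r//; apply: le_trans rho_le.
  rewrite big_seq [leRHS]big_seq; apply: ler_sum => z /hZ[z0 zL].
  by rewrite normrM ler_piMl// discrete_weight_norm_le1.
have n3 : ('N[P]_2%:E[(fun w => (T3 w)%:E)] <= e%:E)%E by rewrite Lnorm2N.
apply: Lnorm2_scale.
- by apply: measurable_funD => //; exact: measurable_funD.
- by rewrite !addr_ge0 ?mulr_ge0// ltW.
- by apply: Lnorm2D => //; [exact: measurable_funD|exact: Lnorm2D].
Qed.

End fields.

Theorem theorem3p7 (R : realType) (d : measure_display)
    (Omega : measurableType d) (P : probability Omega R)
    (n : nat) (n_ge1 : (1 <= n)%N)
    (Zhat : set 'rV[int]_n) (Zhat_half : half_lattice Zhat)
    (xi : 'rV[int]_n -> {RV P >-> R})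
    (xi_iid : iid_standard_normal [set z | z != 0] xi)
    (f : 'rV[R]_n -> R) (alpha : 'rV[int]_n -> R)
    (f_sobolev : exists2 s : R, n%:R / 2 < s & sobolev Zhat s alpha f) :
  'N[P]_2%:E[(fun w => (discrete_pairing L (discrete_field Zhat xi L w)
                          (continuous_version f)
                        - field_pairing xi alpha w)%:E)]%E
    @[L --> within [set L | odd L] \oo] --> 0%E.
Proof.
have [s ns fs] := f_sobolev.
have [M alphaM] := sobolev_summable n_ge1 ns fs.
have [K K0 hK] := Lnorm2_standard_normal P.
have xiK z : z != 0 -> ('N[P]_2%:E[(fun w => (xi z w)%:E)] <= K%:E)%E.
  by move=> z0; apply: hK; exact: (xi_iid.2 z z0).
have [_ f_sum _] := fs.
apply: cvg_within_filter.
have small (e : R) : 0 < e -> \forall L \near \oo,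
    ('N[P]_2%:E[(fun w => (discrete_pairing L (discrete_field Zhat xi L w)
      (continuous_version f) - field_pairing xi alpha w)%:E)] <= e%:E)%E.
  move=> e0; set C := `|@field_const R n `^ (- 2^-1)|.
  (* The bound of [field_error_le] is [C * (K + 2 * K + 1)] times its parameter; adding 1 makes the
     divisor positive whatever the value of [C]. *)
  have c0 : 0 < C * (K + 2 * K + 1) + 1.
    have C0 : 0 <= C by exact: normr_ge0.
    by apply: ltr_wpDl => //; apply: mulr_ge0 => //; lra.
  have := field_error_le Zhat_half alphaM K0 xiK (divr_gt0 e0 c0).
  have : \forall L \near \oo, (0 < L)%N by exact: nbhs_infty_gt.
  apply: filterS2 => -[//|L'] _.
  rewrite (eq_Lnorm _ _ (g := fun w => (discrete_pairing L'.+1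
    (discrete_field Zhat xi L'.+1 w) (continuous_version f) -
    field_pairing xi alpha w)%:E)).
    move=> /le_trans; apply; rewrite lee_fin -/C.
    set c := C * _ + 1 in c0 *.
    rewrite (_ : C * _ = C * (K + 2 * K + 1) * e / c); last by ring.
    by rewrite ler_pdivrMr// (mulrC e) ler_wpM2r ?(ltW e0)// /c lerDl.
  move=> w; congr (_ - _)%:E; apply: discrete_pairing_eqr => x x01.
  by rewrite (continuous_versionE alphaM f_sum x01).
(* The norms are extended reals: eventual finiteness comes from the bound with [e = 1], and the rest
   is real convergence. *)
apply/fine_cvgP; split.
  apply: filterS (small 1 ltr01) => L h.
  by rewrite ge0_fin_numE ?Lnorm_ge0// (le_lt_trans h)// ltry.
apply/cvgrPdist_le => e e0; apply: filterS (small e e0) => L h /=.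
rewrite sub0r normrN ger0_norm ?fine_ge0 ?Lnorm_ge0// -lee_fin fineK//.
by rewrite ge0_fin_numE ?Lnorm_ge0// (le_lt_trans h)// ltry.
Qed.
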